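(* For integers $w,h\ge 0$, let $N_{w,h}(\alpha,\beta)=\sum_T \alpha^{\mathrm{LO}(T)}\beta^{\mathrm{RO}(T)}$, the sum over all non-empty non-ambiguous trees $T$ with $|\mathrm{LV}(T)|=w$ and $|\mathrm{RV}(T)|=h$. Then $$N_{w,h}(\alpha,\beta)=\sum_{p\ge 1}(p-1)!\,\Big(\prod_{j=0}^{p-2}(\alpha+\beta+j)\Big)\,S_{2,\alpha}(w+1,p)\,S_{2,\beta}(h+1,p),$$ and moreover, for each $p\ge1$, the $p$-th summand equals $\sum_T \alpha^{\mathrm{LO}(T)}\beta^{\mathrm{RO}(T)}$ over those non-empty NATs $T$ with $|\mathrm{LV}(T)|=w$, $|\mathrm{RV}(T)|=h$ and hook number equal to $p$.
   Context: A binary tree is a rooted tree in which each vertex has either no child, a left child, a right child, or both. $\mathrm{LV}(B)$ (resp. $\mathrm{RV}(B)$) is the set of left (resp. right) children of $B$; the root is in neither. A non-ambiguous tree (NAT) is a non-empty binary tree $B$ with a labelling of its left children bijectively by $1,\dots,|\mathrm{LV}(B)|$ and of its right children bijectively by $1,\dots,|\mathrm{RV}(B)|$, such that whenever $U,V$ are both left children (resp. both right children) and $U$ is a proper ancestor of $V$, the label of $U$ exceeds that of $V$. For a vertex $v$ of a binary tree, its leftmost branch is the maximal chain $v_1,v_2,\dots$ where $v_1$ is the left child of $v$ and $v_{j+1}$ is the left child of $v_j$; its rightmost branch is defined symmetrically. $\mathrm{LO}(T)$ (resp. $\mathrm{RO}(T)$) is the number of vertices in the leftmost (resp. rightmost)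 branch of the root. The hook of $v$ is $\{v\}$ together with its leftmost and rightmost branches. The vertices of a binary tree are partitioned into hooks by taking the hook of the root, removing it, and recursing on each tree of the remaining forest; the number of parts is the hook number of the tree (of a NAT: of its underlying tree). For a formal parameter $q$ and integers $n\ge1$, $p\ge1$, $S_{2,q}(n,p)=\sum_{\pi} q^{|B_1(\pi)|-1}$, where $\pi$ ranges over set partitions of $\{1,\dots,n\}$ into $p$ blocks and $B_1(\pi)$ is the block containing $1$. The empty product (for $p=1$) equals $1$. *)

(* Defs.v *)
From HB Require Import structures.
From mathcomp Require Import all_boot all_order all_algebra zify.
Set Implicit Arguments.
Unset Strict Implicit.
Unset Printing Implicit Defensive.
Import GRing.Theory.
Local Open Scope nat_scope.

Inductive bintree := bt_empty | bt_node of bintree & bintree.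

Fixpoint bt_encode (B : bintree) : GenTree.tree unit :=
  if B is bt_node l r then GenTree.Node 1 [:: bt_encode l; bt_encode r]
  else GenTree.Node 0 [::].

Fixpoint bt_decode (t : GenTree.tree unit) : bintree :=
  if t is GenTree.Node _ [:: l; r] then bt_node (bt_decode l) (bt_decode r)
  else bt_empty.

Lemma bt_encodeK : cancel bt_encode bt_decode.
Proof. by elim=> //= l -> r ->. Qed.

HB.instance Definition _ := Countable.copy bintree (can_type bt_encodeK).

(* A vertex is the path leading to it from the root: at each step, the left
   child (dleft) or the right child (dright) is taken. The root is [::]. *)
Notation vertex := (seq bool).
Definition dleft : bool := false.
Definition dright : bool := true.

Fixpoint vertices (B : bintree) : seq vertex :=
  if B is bt_node l r then
    [::] :: map (cons dleft) (vertices l) ++ map (cons dright) (vertices r)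
  else [::].

Definition children (d : bool) (B : bintree) : seq vertex :=
  [seq v <- [seq rcons u d | u <- vertices B] | v \in vertices B].

Definition LV := children dleft.
Definition RV := children dright.

Definition proper_ancestor (u v : vertex) : bool := (u != v) && prefix u v.

(* The leftmost (d = dleft) or rightmost (d = dright) branch of the root of B;
   it has fewer vertices than B, hence the bound on the number of steps. *)
Definition branch (d : bool) (B : bintree) : seq vertex :=
  [seq v <- [seq nseq k.+1 d | k <- iota 0 (size (vertices B))]
     | v \in vertices B].

Definition root_hook (B : bintree) : seq vertex :=
  [::] :: branch dleft B ++ branch dright B.

(* When B is the subtree rooted at the vertex v of a larger tree, this lists the
   hooks of B as sets of vertices of that larger tree: the hook of v, then the
   hooks of the trees of the forest left once it is removed. These trees are
   the right subtrees of the vertices of the leftmost branch of v and the left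
   subtrees of the vertices of its rightmost branch; the two inner loops walk
   along these branches. *)
Fixpoint hooks_from (v : vertex) (B : bintree) : seq (seq vertex) :=
  if B is bt_node l r then
    [seq v ++ u | u <- root_hook B] ::
      (fix along_left (u : vertex) (t : bintree) : seq (seq vertex) :=
         if t is bt_node l' r' then
           hooks_from (rcons u dright) r' ++ along_left (rcons u dleft) l'
         else [::]) (rcons v dleft) l ++
      (fix along_right (u : vertex) (t : bintree) : seq (seq vertex) :=
         if t is bt_node l' r' then
           hooks_from (rcons u dleft) l' ++ along_right (rcons u dright) r'
         else [::]) (rcons v dright) r
  else [::].

Definition hooks (B : bintree) : seq (seq vertex) := hooks_from [::] B.

Definition hook_number (B : bintree) : nat := size (hooks B).

Lemma mem_map_cons (b b' : bool) (s : seq vertex) u :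
  (b :: u \in map (cons b') s) = (b == b') && (u \in s).
Proof.
apply/mapP/andP => [[x xs [-> ->]]|[/eqP-> us]]; first by [].
by exists u.
Qed.

Lemma nil_map_cons b (s : seq vertex) : ([::] \in map (cons b) s) = false.
Proof. by apply/negP => /mapP[]. Qed.

Lemma cons_inj (b : bool) : injective (cons b).
Proof. by move=> ? ? []. Qed.

Lemma mem_vertices_node d v l r :
  (d :: v \in vertices (bt_node l r)) = (v \in vertices (if d then r else l)).
Proof.
by rewrite /= inE mem_cat !mem_map_cons; case: d => //=; rewrite orbF.
Qed.

Lemma vertices_uniq B : uniq (vertices B).
Proof.
elim: B => //= l ul r ur.
rewrite mem_cat cat_uniq !(map_inj_uniq (@cons_inj _)) ul ur andbT /=.
apply/andP; split.
  by rewrite !nil_map_cons.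
by apply/hasPn => x /mapP[y _ ->]; rewrite mem_map_cons.
Qed.

Lemma root_in_vertices B : ([::] \in vertices B) = (B != bt_empty).
Proof. by case: B. Qed.

Lemma size_vertices_gt B v : v \in vertices B -> size v < size (vertices B).
Proof.
elim: B v => // l IHl r IHr [|d v] //; rewrite mem_vertices_node /= size_cat.
rewrite !size_map ltnS.
case: d => [/IHr|/IHl] H; apply: leq_trans H _; first exact: leq_addl.
exact: leq_addr.
Qed.

Lemma children_uniq d B : uniq (children d B).
Proof.
apply: filter_uniq; rewrite map_inj_uniq ?vertices_uniq //.
by move=> u v /rcons_inj[].
Qed.

Lemma vertices_rcons d v B : rcons v d \in vertices B -> v \in vertices B.
Proof.
elim: B v => // l IHl r IHr [|b v] //.
rewrite rcons_cons !mem_vertices_node; case: b; [exact: IHr|exact: IHl].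
Qed.

Lemma mem_children d B v :
  (v \in children d B) = [&& v != [::], last d v == d & v \in vertices B].
Proof.
rewrite mem_filter; apply/andP/and3P => [[vB /mapP[u _ vE]]|[]].
  by rewrite vB vE -size_eq0 size_rcons last_rcons eqxx.
case/lastP: v => // u b _; rewrite last_rcons => /eqP-> H; split=> //.
exact/map_f/(vertices_rcons H).
Qed.

Lemma size_children d l r :
  size (children d (bt_node l r)) =
    ((if d then r else l) != bt_empty) + size (children d l)
    + size (children d r).
Proof.
rewrite -addnA -size_cat.
pose C := (if (if d then r else l) != bt_empty then [:: [:: d]] else [::]) ++
  map (cons dleft) (children d l) ++ map (cons dright) (children d r).
suff /perm_size -> : perm_eq (children d (bt_node l r)) C.
  by rewrite /C !size_cat !size_map; case: (_ != _).
apply: uniq_perm; first exact: children_uniq.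
  rewrite /C !cat_uniq !(map_inj_uniq (@cons_inj _)) !children_uniq /= andbT.
  apply/and3P; split; first by case: ifP.
    apply/hasPn => x; rewrite mem_cat; case: ifP => // _ /orP[] /mapP[y yc ->];
    by rewrite inE; apply/negP => /eqP[_ y0]; rewrite y0 mem_children in yc.
  by apply/hasPn => x /mapP[y _ ->]; rewrite mem_map_cons.
move=> v; rewrite mem_children {}/C !mem_cat.
case: v => [|b v] /=.
  by rewrite !nil_map_cons; case: ifP.
have -> : (b :: v \in (if (if d then r else l) != bt_empty then [:: [:: d]]
   else [::])) = [&& b == d, v == [::] & [::] \in vertices (if d then r else l)].
  rewrite root_in_vertices; case: ifP => _; last by rewrite !andbF.
  by rewrite inE eqseq_cons andbT.
rewrite mem_vertices_node.
have -> : (last b v == d) = (if v == [::] then b == d else last d v == d).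
  by case: v.
rewrite !mem_map_cons !mem_children.
by case: b; case: d; case: (eqVneq v [::]) => [->|_] //=; rewrite ?orbF ?andbF.
Qed.

Lemma size_vertices B :
  size (vertices B) = (B != bt_empty) + size (LV B) + size (RV B).
Proof.
rewrite /LV /RV; elim: B => // l IHl r IHr.
by rewrite !size_children /= size_cat !size_map IHl IHr; lia.
Qed.

Lemma mem_branch d B v :
  (v \in branch d B) = [&& v != [::], v == nseq (size v) d & v \in vertices B].
Proof.
rewrite mem_filter; apply/andP/and3P => [[vB /mapP[k _ vE]]|[v0 /eqP vE vB]].
  by rewrite vB vE size_nseq eqxx.
split=> //; apply/mapP; exists (size v).-1.
  rewrite mem_iota /= add0n; apply: leq_ltn_trans (leq_pred _) _.
  exact: size_vertices_gt.
by rewrite prednK // lt0n size_eq0.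
Qed.

Lemma branch_uniq d B : uniq (branch d B).
Proof.
apply/filter_uniq; rewrite map_inj_uniq ?iota_uniq // => i j.
by move/(congr1 size); rewrite !size_nseq => -[].
Qed.

Lemma branch_node d l r :
  perm_eq (branch d (bt_node l r))
    (map (cons d) (let B := if d then r else l in
       if B is bt_empty then [::] else [::] :: branch d B)).
Proof.
apply: uniq_perm; first exact: branch_uniq.
  rewrite (map_inj_uniq (@cons_inj _)) /=.
  by case: (if d then r else l) => //= l' r'; rewrite branch_uniq mem_branch.
move=> [|b v]; first by rewrite mem_branch nil_map_cons.
rewrite mem_map_cons mem_branch mem_vertices_node eqseq_cons /=.
case: (eqVneq b d) => [->|//] /=.
case: (if d then r else l) => [|l' r']; first by rewrite andbF.
rewrite [RHS]inE mem_branch.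
by case: (eqVneq v [::]) => [->|]; rewrite ?andbT.
Qed.

(* The hooks of B do form a partition of its set of vertices. *)
Lemma hooks_perm B : perm_eq (flatten (hooks B)) (vertices B).
Proof.
pose chain d t := if t is bt_empty then [::] else [::] :: branch d t.
pose al := fix along_left (u : vertex) (t : bintree) : seq (seq vertex) :=
  if t is bt_node l r then
    hooks_from (rcons u dright) r ++ along_left (rcons u dleft) l
  else [::].
pose ar := fix along_right (u : vertex) (t : bintree) : seq (seq vertex) :=
  if t is bt_node l r then
    hooks_from (rcons u dleft) l ++ along_right (rcons u dright) r
  else [::].
have catE v d s : [seq v ++ u | u <- map (cons d) s] = map (cat (rcons v d)) s.
  by rewrite -map_comp; apply: eq_map => u /=; rewrite cat_rcons.
have brE v d l r : perm_eq [seq v ++ u | u <- branch d (bt_node l r)]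
    (map (cat (rcons v d)) (chain d (if d then r else l))).
  by rewrite -catE; apply/perm_map/branch_node.
suff H : [/\ forall v, perm_eq (flatten (hooks_from v B))
                         [seq v ++ u | u <- vertices B],
    forall v, perm_eq (map (cat v) (chain dleft B) ++ flatten (al v B))
                         [seq v ++ u | u <- vertices B]
  & forall v, perm_eq (map (cat v) (chain dright B) ++ flatten (ar v B))
                         [seq v ++ u | u <- vertices B]].
  by case: H => /(_ [::]); rewrite map_id.
elim: B => [|l [hl al_l ar_l] r [hr al_r ar_r]]; first by [].
have E v a : count a [seq v ++ u | u <- vertices (bt_node l r)] =
    a v + count a (map (cat (rcons v dleft)) (vertices l))
    + count a (map (cat (rcons v dright)) (vertices r)).
  by rewrite /= map_cat !catE count_cat cats0 addnA.
have BL v a := permP (brE v dleft l r) a.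
have BR v a := permP (brE v dright l r) a.
have HL v a := permP (hl v) a; have HR v a := permP (hr v) a.
have AL v a := permP (al_l v) a; have AR v a := permP (ar_r v) a.
split=> v; apply/permP => a; rewrite E.
- rewrite -[hooks_from v _]/((map (cat v) (root_hook (bt_node l r))) ::
    al (rcons v dleft) l ++ ar (rcons v dright) r).
  rewrite /= flatten_cat !count_cat cats0 map_cat count_cat BL BR /=.
  by rewrite -AL -AR !count_cat -[RHS]addnA; congr addn; exact: addnACA.
- rewrite -[al v _]/(hooks_from (rcons v dright) r ++ al (rcons v dleft) l).
  rewrite flatten_cat !count_cat /= cats0 BL HR -AL count_cat -!addnA.
  by congr addn; congr addn; rewrite addnC.
- rewrite -[ar v _]/(hooks_from (rcons v dleft) l ++ ar (rcons v dright) r).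
  rewrite flatten_cat !count_cat /= cats0 BR HL -AR count_cat -!addnA.
  by congr addn; exact: addnCA.
Qed.

Definition LO (B : bintree) : nat := size (branch dleft B).
Definition RO (B : bintree) : nat := size (branch dright B).

Fixpoint trees_upto (n : nat) : seq bintree :=
  if n is m.+1 then
    bt_empty :: [seq bt_node l r | l <- trees_upto m, r <- trees_upto m]
  else [:: bt_empty].

Lemma trees_upto_uniq n : uniq (trees_upto n).
Proof.
elim: n => //= n un; rewrite allpairs_uniq ?andbT //.
  by apply/negP => /allpairsP[[l r] []].
by move=> [l r] [l' r'] _ _ [-> ->].
Qed.

Lemma mem_trees_upto n B : size (vertices B) <= n -> B \in trees_upto n.
Proof.
elim: n B => [|n IH] [|l r] //=; rewrite size_cat !size_map => H.
rewrite inE; apply/orP; right; apply: allpairs_f; apply: IH; lia.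
Qed.

Definition has_shape (w h : nat) (B : bintree) : bool :=
  [&& B != bt_empty, size (LV B) == w & size (RV B) == h].

Record shape (w h : nat) :=
  Shape {shape_tree :> bintree; _ : has_shape w h shape_tree}.

HB.instance Definition _ w h := [isSub for @shape_tree w h].
HB.instance Definition _ w h := [Countable of shape w h by <:].

Definition shape_enum w h : seq (shape w h) :=
  pmap insub (trees_upto (w + h).+1).

Lemma shape_enumP w h : Finite.axiom (shape_enum w h).
Proof.
apply: Finite.uniq_enumP => [|[B BP]].
  exact/pmap_sub_uniq/trees_upto_uniq.
rewrite mem_pmap_sub; apply: mem_trees_upto; move: (BP).
by rewrite /= size_vertices => /and3P[-> /eqP-> /eqP->].
Qed.

HB.instance Definition _ w h := isFinite.Build (shape w h) (@shape_enumP w h).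

(* A label i : 'I_n stands for the label i + 1 of {1, ..., n}. *)
Definition labelling (s : seq vertex) (n : nat) := {ffun seq_sub s -> 'I_n}.

Definition bijective_labelling s n (f : labelling s n) : bool :=
  injectiveb f && [forall i, i \in codom f].

Definition decreasing_labelling s n (f : labelling s n) : bool :=
  [forall u, forall v, proper_ancestor (val u) (val v) ==> (f v < f u)].

Definition NAT_labelling s n (f : labelling s n) : bool :=
  bijective_labelling f && decreasing_labelling f.

(* The non-ambiguous trees with w left and h right children: an underlying
   tree, the labels of its left children and the labels of its right ones. *)
Definition NAT (w h : nat) : finType :=
  {T : {B : shape w h & (labelling (LV B) w * labelling (RV B) h)%type}
     | NAT_labelling (tagged T).1 && NAT_labelling (tagged T).2}.

Definition NAT_tree w h (T : NAT w h) : bintree := tag (val T).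

Local Open Scope ring_scope.

Definition NAT_weight (R : comNzRingType) (alpha beta : R)
    w h (T : NAT w h) : R :=
  alpha ^+ LO (NAT_tree T) * beta ^+ RO (NAT_tree T).

Definition NAT_poly (R : comNzRingType) (w h : nat) (alpha beta : R) : R :=
  \sum_(T : NAT w h) NAT_weight alpha beta T.

(* {1, ..., n} is encoded as 'I_n, so that 1 becomes ord0; n = 0 is junk. *)
Definition S2q (R : comNzRingType) (q : R) (n p : nat) : R :=
  if n is m.+1 then
    \sum_(P : {set {set 'I_m.+1}} | partition P setT && (#|P| == p))
      q ^+ (#|pblock P ord0|).-1
  else 0.

(* The p-th summand of the formula, for p > 0 *)
Definition hook_summand (R : comNzRingType) (w h : nat) (alpha beta : R)
    (p : nat) : R :=
  (p.-1)`!%:R * (\prod_(0 <= j < p.-1) (alpha + beta + j%:R))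
    * S2q alpha w.+1 p * S2q beta h.+1 p.

(* Main.v *)
(* Exponential generating functions in two variables x, y (for left and right
   children): a forest of decreasingly labelled trees is a product, and adding a
   root is an integration. Let t mark the hooks. Let A and B be the series of
   the possible left and right subtrees of the root, counted with
   alpha ^ (length of the leftmost branch) and beta ^ (length of the rightmost
   branch), let F = t A B be the series of the non-ambiguous trees, and let F1 be
   F for alpha = beta = 1. Removing the root of a subtree gives
     A = 1 + alpha int_x (A U),  U = 1 + int_y F1,
     B = 1 + beta  int_y (B W),  W = 1 + int_x F1.
   In the coordinates X = exp x - 1, Y = exp y - 1 this system is solved by
   A = exp(alpha x) (1 - t X Y) ^ (- alpha) and the symmetric B, so
     F = t exp(alpha x) exp(beta y) (1 - t X Y) ^ (- alpha - beta).
   Expanding in powers of t gives the formula, as exp(q x) X ^ (p-1) / (p-1)! is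
   the exponential generating function of n |-> S_{2,q}(n+1, p). *)
From HB Require Import structures.
Require Import Defs.
From mathcomp Require Import all_boot all_order all_algebra.
From mathcomp Require Import boolp.
From mathcomp Require Import ring zify.
Set Implicit Arguments.
Unset Strict Implicit.
Unset Printing Implicit Defensive.
Import GRing.Theory.

(** * Decreasing labellings *)

Local Open Scope nat_scope.

Definition maximal_in (s : seq vertex) (v : vertex) : bool :=
  all (fun u => ~~ proper_ancestor u v) s.

(* Counts the orderings of s in which no vertex comes after one of its
   descendants, by choosing the first one. *)
Fixpoint lab_count (s : seq vertex) (n : nat) : nat :=
  if n is m.+1 then \sum_(v <- s | maximal_in s v) lab_count (rem v s) m
  else s == [::].

Lemma lab_countS s n :
  lab_count s n.+1 = \sum_(v <- s | maximal_in s v) lab_count (rem v s) n.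
Proof. by []. Qed.

Definition ancestor_first (t : seq vertex) : bool :=
  pairwise (fun u v => ~~ proper_ancestor v u) t.

Lemma lab_count_size s n : size s != n -> lab_count s n = 0.
Proof.
elim: n s => [|n IH] s /=; first by case: s.
move=> sn; apply: big1_seq => v /andP[_ vs]; apply: IH.
by apply: contraNneq sn => <-; rewrite size_rem //; case: s vs.
Qed.

Lemma proper_ancestor_irr v : proper_ancestor v v = false.
Proof. by rewrite /proper_ancestor eqxx. Qed.

Lemma perm_permutations_rem (T : eqType) (s : seq T) : uniq s -> s != [::] ->
  perm_eq (permutations s)
    [seq v :: t | v <- s, t <- permutations (rem v s)].
Proof.
move=> us s0; apply: uniq_perm; first exact: permutations_uniq.
  apply: allpairs_uniq_dep => //.
    by move=> v _; exact: permutations_uniq.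
  by move=> [v t] [v' t'] _ _ /= [-> ->].
move=> t; rewrite mem_permutations; apply/idP/allpairsPdep => [ts|].
  case: t ts => [/perm_size|v t ts].
    by case: s s0 {us}.
  have vs : v \in s by rewrite -(perm_mem ts) mem_head.
  exists v, t; split=> //; rewrite mem_permutations.
  by rewrite -(perm_cons v) (perm_trans ts) // perm_to_rem.
move=> [v [t' [vs]]]; rewrite mem_permutations => t's ->.
by rewrite perm_sym (perm_trans (perm_to_rem vs)) // perm_cons perm_sym.
Qed.

(** An ancestor-first ordering starts with a vertex having no proper ancestor in [s], and its tail
    is any ancestor-first ordering of the rest; this is the recursion of [lab_count]. *)
Lemma count_ancestor_first s : uniq s ->
  count ancestor_first (permutations s) = lab_count s (size s).
Proof.
move Es : (size s) => n; elim: n s Es => [|n IH] s Es us.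
  by case: s Es {us}.
have s0 : s != [::] by case: s Es {us}.
rewrite (permP (perm_permutations_rem us s0)) count_flatten -map_comp sumnE.
rewrite big_map lab_countS [RHS]big_mkcond big_seq [RHS]big_seq.
apply: eq_bigr => v vs; rewrite /= count_map.
have srem : size (rem v s) = n by rewrite size_rem // Es.
have -> : maximal_in s v = all (fun u => ~~ proper_ancestor u v) (rem v s).
  by rewrite /maximal_in (perm_all _ (perm_to_rem vs)) /= proper_ancestor_irr.
rewrite -IH ?rem_uniq //.
case: ifP => mv.
  apply: eq_in_count => t; rewrite mem_permutations => ts.
  by rewrite /ancestor_first /= (perm_all _ ts) mv.
rewrite -[RHS](count_pred0 (permutations (rem v s))).
apply: eq_in_count => t; rewrite mem_permutations => ts.
by rewrite /ancestor_first /= (perm_all _ ts) mv.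
Qed.

(** Labels decrease from ancestor to descendant, so reading the vertices by decreasing label turns a
    labelling into an ancestor-first ordering. *)
Definition lab_order s n (f : labelling s n) : seq vertex :=
  [seq val u | u <- sort (fun u v => f v <= f u) (enum {: seq_sub s})].

Lemma val_enum_seq_sub (s : seq vertex) : uniq s ->
  perm_eq [seq val u | u <- enum {: seq_sub s}] s.
Proof.
move=> us; apply: uniq_perm => //.
  by rewrite map_inj_uniq ?enum_uniq //; exact: val_inj.
move=> v; apply/mapP/idP => [[u _ ->]|vs]; first exact: ssvalP.
by exists (SeqSub vs); rewrite ?mem_enum.
Qed.

Lemma card_seq_sub_uniq (s : seq vertex) : uniq s -> #|{: seq_sub s}| = size s.
Proof.
by move=> us; rewrite -(perm_size (val_enum_seq_sub us)) size_map -cardE.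
Qed.

Lemma perm_lab_order s n (f : labelling s n) : uniq s -> perm_eq (lab_order f) s.
Proof.
move=> us; apply: perm_trans (val_enum_seq_sub us).
by apply: perm_map; rewrite perm_sort.
Qed.

Lemma sort_labelling s n (f : labelling s n) : bijective_labelling f ->
  [seq f u : nat | u <- sort (fun u v => f v <= f u) (enum {: seq_sub s})] =
  rev (iota 0 n).
Proof.
case/andP=> /injectiveP injf /forallP surjf.
have fnI : injective (fun u => f u : nat) by move=> u v /val_inj/injf.
apply: (@sorted_eq _ geq).
- by move=> y x z xy yz; exact: leq_trans yz xy.
- by move=> x y /andP[xy yx]; apply/eqP; rewrite eqn_leq; apply/andP.
- rewrite sorted_map; apply: sort_sorted => u v; exact: leq_total.
- by rewrite rev_sorted; exact: iota_sorted.
apply: uniq_perm.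
- by rewrite map_inj_uniq // sort_uniq enum_uniq.
- by rewrite rev_uniq iota_uniq.
move=> i; rewrite mem_rev mem_iota /= add0n; apply/mapP/idP => [[u _ ->]|i_n].
  exact: ltn_ord.
have /codomP[u fu] := surjf (Ordinal i_n).
by exists u; rewrite ?mem_sort ?mem_enum // -fu.
Qed.

(** Along [lab_order f] the labels run through [n - 1], ..., [0], so the position of a vertex
    determines its label. Hence the ordering determines the labelling. *)
Lemma labelling_index s n (f : labelling s n) (u : seq_sub s) : size s = n ->
  uniq s -> bijective_labelling f ->
  f u = n - (index (val u) (lab_order f)).+1 :> nat.
Proof.
move=> sn us bf; rewrite /lab_order; set e := sort _ _.
have ue : u \in e by rewrite mem_sort mem_enum.
have se : size e = n by rewrite size_sort -cardE card_seq_sub_uniq.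
rewrite index_map; last exact: val_inj.
have /(congr1 (fun s => nth 0 s (index u e))) := sort_labelling bf.
rewrite -/e (nth_map u) ?index_mem // nth_index // => ->.
have ie : index u e < n by rewrite -se index_mem.
by rewrite nth_rev size_iota // nth_iota ?add0n; lia.
Qed.

Lemma lab_order_inj s n : size s = n -> uniq s ->
  {in [pred f : labelling s n | bijective_labelling f] &, injective (@lab_order s n)}.
Proof.
move=> sn us f g bf bg fg; apply/ffunP => u; apply/val_inj.
by rewrite /= !labelling_index // fg.
Qed.

Lemma ancestor_first_lab_order s n (f : labelling s n) :
  decreasing_labelling f -> ancestor_first (lab_order f).
Proof.
move=> /forallP df; rewrite /ancestor_first /lab_order pairwise_map.
have tr : transitive (fun u v : seq_sub s => f v <= f u).
  by move=> y x z xy yz; exact: leq_trans yz xy.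
have : sorted (fun u v : seq_sub s => f v <= f u)
    (sort (fun u v => f v <= f u) (enum {: seq_sub s})).
  by apply: sort_sorted => u v; exact: leq_total.
rewrite (sorted_pairwise tr); apply: sub_pairwise => u v /= fvu.
apply/negP => vu; have /forallP/(_ u) := df v.
by rewrite vu /= ltnNge fvu.
Qed.

Lemma order_lab_bound s n (t : seq vertex) (u : seq_sub s) :
  size s = n -> n - (index (val u) t).+1 < n.
Proof.
(* The point is that [n] is positive, since [u] lies in [s]. *)
move=> <-; have : index (val u) s < size s by rewrite index_mem; exact: ssvalP.
by lia.
Qed.

(** Inverse of [lab_order] on ancestor-first orderings: the first vertex receives the greatest
    label. *)
Definition order_lab s n (sn : size s = n) (t : seq vertex) : labelling s n :=
  [ffun u => Ordinal (order_lab_bound t u sn)].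

Lemma order_lab_NAT s n (sn : size s = n) t : uniq s -> perm_eq t s ->
  ancestor_first t -> NAT_labelling (order_lab sn t).
Proof.
move=> us ts af; have st : size t = n by rewrite (perm_size ts).
have ut : uniq t by rewrite (perm_uniq ts).
pose ix (u : seq_sub s) := index (val u) t.
have ixn u : ix u < n by rewrite -st index_mem (perm_mem ts) ssvalP.
have fE u : order_lab sn t u = n - (ix u).+1 :> nat by rewrite ffunE.
have inj : injective (order_lab sn t).
  move=> u v /(congr1 val) /=; rewrite !fE => uv.
  have uv' : ix u = ix v by move: uv (ixn u) (ixn v); lia.
  apply/val_inj; rewrite -(nth_index [::] (s := t) (x := val u)).
    by rewrite -/(ix u) uv' nth_index // (perm_mem ts) ssvalP.
  by rewrite (perm_mem ts) ssvalP.
apply/andP; split.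
  apply/andP; split; first exact/injectiveP.
  by apply/forallP/(inj_card_onto inj); rewrite card_ord card_seq_sub_uniq ?sn.
apply/forallP => u; apply/forallP => v; apply/implyP => uv; rewrite !fE.
suff : ix u < ix v by move: (ixn u) (ixn v); lia.
rewrite ltnNge; apply/negP; rewrite leq_eqVlt => /orP[/eqP vu|vu].
  have vu' : val v = val u.
    rewrite -(nth_index [::] (s := t) (x := val v)) ?(perm_mem ts) ?ssvalP //.
    by rewrite -/(ix v) vu nth_index // (perm_mem ts) ssvalP.
  by rewrite vu' proper_ancestor_irr in uv.
have /(pairwiseP [::])/(_ (index (val v) t) (index (val u) t)) := af.
rewrite !inE !index_mem !nth_index ?(perm_mem ts) ?ssvalP // uv.
by move=> /(_ isT isT vu).
Qed.

Lemma order_labK s n (sn : size s = n) t : uniq s -> perm_eq t s ->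
  lab_order (order_lab sn t) = t.
Proof.
move=> us ts; have st : size t = n by rewrite (perm_size ts).
have ut : uniq t by rewrite (perm_uniq ts).
set f := order_lab sn t; have pt := perm_lab_order f us.
(* A permutation of [t] is recovered from the positions of its entries in [t]. Both lists of
   positions are increasing and permutations of each other, hence equal. *)
suff E : [seq index x t | x <- lab_order f] = [seq index x t | x <- t].
  have K (t' : seq vertex) : perm_eq t' s ->
      t' = [seq nth [::] t i | i <- [seq index x t | x <- t']].
    move=> t's; rewrite -map_comp map_id_in // => x xt' /=.
    by rewrite nth_index // (perm_mem ts) -(perm_mem t's).
  by rewrite (K _ pt) E -K.
apply: (sorted_eq leq_trans anti_leq).
- rewrite sorted_map /lab_order sorted_map.
  have /= := @sort_sorted _ (fun u v => f v <= f u) _ (enum {: seq_sub s}).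
  move=> /(_ (fun u v => leq_total _ _)); apply: sub_sorted => u v /=.
  pose ix (w : seq_sub s) := index (val w) t.
  have ixn w : ix w < n by rewrite -st index_mem (perm_mem ts) ssvalP.
  rewrite /f !ffunE -/(ix u) -/(ix v) /=.
  by move: (ixn u) (ixn v); lia.
- suff -> : [seq index x t | x <- t] = iota 0 (size t) by exact: iota_sorted.
  apply: (@eq_from_nth _ 0); rewrite size_map ?size_iota // => i it.
  by rewrite (nth_map [::]) // index_uniq // nth_iota.
by apply/perm_map/(perm_trans pt); rewrite perm_sym.
Qed.

(** [lab_order] and [order_lab] are inverse bijections between the labellings and the ancestor-first
    orderings. *)
Lemma card_NAT_labelling s n : size s = n -> uniq s ->
  #|[pred f : labelling s n | NAT_labelling f]| = lab_count s n.
Proof.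
move=> sn us; have -> : lab_count s n = count ancestor_first (permutations s).
  by rewrite count_ancestor_first // sn.
rewrite -size_filter.
rewrite cardE -(size_map (@lab_order s n)); apply/perm_size/uniq_perm.
- rewrite map_inj_in_uniq ?enum_uniq // => f g.
  rewrite !mem_enum !inE => /andP[bf _] /andP[bg _]; exact: lab_order_inj.
- by rewrite filter_uniq // permutations_uniq.
move=> t; rewrite mem_filter mem_permutations; apply/mapP/andP.
  move=> [f]; rewrite mem_enum inE => /andP[bf df] ->.
  by rewrite ancestor_first_lab_order // perm_lab_order.
move=> [af ts]; exists (order_lab sn t); last by rewrite order_labK.
by rewrite mem_enum inE order_lab_NAT.
Qed.

Local Open Scope ring_scope.

(** * Exponential series *)

(* The sequence f stands for the exponential (Hurwitz) series
   sum_n f_n x ^ n / n!, which needs no division in the ring of coefficients: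
   differentiation is a shift, and the Leibniz rule defines the product. *)
Definition hseries (R : Type) : Type := nat -> R.

HB.instance Definition _ (R : Type) := gen_eqMixin (hseries R).
HB.instance Definition _ (R : Type) := gen_choiceMixin (hseries R).

Definition hder (R : Type) (f : hseries R) : hseries R := fun n => f n.+1.

Definition hadd (R : nmodType) (f g : hseries R) : hseries R :=
  fun n => f n + g n.
Definition hopp (R : zmodType) (f : hseries R) : hseries R := fun n => - f n.
Definition hzero (R : nmodType) : hseries R := fun=> 0.

Lemma haddA (R : zmodType) : associative (@hadd R).
Proof. by move=> f g h; apply/funext => n; exact: addrA. Qed.
Lemma haddC (R : zmodType) : commutative (@hadd R).
Proof. by move=> f g; apply/funext => n; exact: addrC. Qed.
Lemma hadd0 (R : zmodType) : left_id (@hzero R) (@hadd R).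
Proof. by move=> f; apply/funext => n; exact: add0r. Qed.
Lemma haddN (R : zmodType) : left_inverse (@hzero R) (@hopp R) (@hadd R).
Proof. by move=> f; apply/funext => n; exact: addNr. Qed.

HB.instance Definition _ (R : zmodType) :=
  GRing.isZmodule.Build (hseries R) (@haddA R) (@haddC R) (@hadd0 R) (@haddN R).

Definition hconst (R : nmodType) (c : R) : hseries R :=
  fun n => if n is 0 then c else 0.

Fixpoint hmul_rec (R : pzRingType) (f g : hseries R) (n : nat) : R :=
  if n is m.+1 then hmul_rec (hder f) g m + hmul_rec f (hder g) m
  else f 0%N * g 0%N.
Definition hmul (R : pzRingType) (f g : hseries R) : hseries R := hmul_rec f g.

Lemma hmulDl (R : pzRingType) : left_distributive (@hmul R) (@hadd R).
Proof.
move=> f g h; apply/funext => n; rewrite /hmul.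
elim: n f g h => [|n IH] f g h /=; first exact: mulrDl.
rewrite /hadd /= addrACA; congr (_ + _); exact: IH.
Qed.

Lemma hmulC (R : comPzRingType) : commutative (@hmul R).
Proof.
move=> f g; apply/funext => n; rewrite /hmul.
by elim: n f g => [|n IH] f g /=; [exact: mulrC | rewrite addrC !(IH g) !(IH (hder g))].
Qed.

Lemma hmulDr (R : comPzRingType) : right_distributive (@hmul R) (@hadd R).
Proof. by move=> f g h; rewrite !(hmulC f) hmulDl. Qed.

(** By the Leibniz rule a coefficient of positive index is a sum of three triple products of lower
    index, each with one factor differentiated. *)
Lemma hmulA (R : comPzRingType) : associative (@hmul R).
Proof.
move=> f g h; apply/funext => n.
elim: n f g h => [|n IH] f g h; first exact: mulrA.
have E (a b : hseries R) : hmul a b n.+1 = hmul (hder a) b n + hmul a (hder b) n.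
  by [].
have E' (a b : hseries R) :
  hder (hmul a b) = hadd (hmul (hder a) b) (hmul a (hder b)) by [].
rewrite !E !E' hmulDr hmulDl /hadd !IH; exact: addrA.
Qed.

Lemma hmul1 (R : comNzRingType) : left_id (hconst (1 : R)) (@hmul R).
Proof.
have mul0 (f : hseries R) n : hmul (@hzero R) f n = 0.
  elim: n f => [|n IH] f; first exact: mul0r.
  have -> : hmul (hzero R) f n.+1 = hmul (hzero R) f n + hmul (hzero R) (hder f) n.
    by [].
  by rewrite !IH addr0.
move=> f; apply/funext => n.
elim: n f => [|n IH] f; first exact: mul1r.
have -> : hmul (hconst 1) f n.+1 = hmul (hzero R) f n + hmul (hconst 1) (hder f) n.
  by [].
by rewrite mul0 IH add0r.
Qed.

Lemma hconst1_neq0 (R : comNzRingType) : hconst (1 : R) != @hzero R.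
Proof.
apply/eqP => /(congr1 (fun f : hseries R => f 0%N)) /eqP.
by rewrite oner_eq0.
Qed.

HB.instance Definition _ (R : comNzRingType) :=
  GRing.Zmodule_isComNzRing.Build (hseries R)
    (@hmulA R) (@hmulC R) (@hmul1 R) (@hmulDl R) (@hconst1_neq0 R).

Lemma hcoef0 (R : comNzRingType) n : (0 : hseries R) n = 0.
Proof. by []. Qed.

Lemma hcoefD (R : comNzRingType) (f g : hseries R) n : (f + g) n = f n + g n.
Proof. by []. Qed.

Lemma hcoefM0 (R : comNzRingType) (f g : hseries R) :
  (f * g) 0%N = f 0%N * g 0%N.
Proof. by []. Qed.

Lemma hcoefMS (R : comNzRingType) (f g : hseries R) n :
  (f * g) n.+1 = (hder f * g) n + (f * hder g) n.
Proof. by []. Qed.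

Lemma hcoef_sum (R : comNzRingType) I (r : seq I) P (F : I -> hseries R) n :
  (\sum_(i <- r | P i) F i) n = \sum_(i <- r | P i) F i n.
Proof. exact: (big_morph (fun f : hseries R => f n)). Qed.

Lemma hconstM (R : comNzRingType) (c : R) (f : hseries R) n :
  (hconst c * f) n = c * f n.
Proof.
elim: n f => [|n IH] f //.
have -> : (hconst c * f) n.+1 = (0 * f) n + (hconst c * hder f) n by [].
by rewrite mul0r IH hcoef0 add0r.
Qed.

Definition hprim (R : nmodType) (f : hseries R) : hseries R :=
  fun n => if n is m.+1 then f m else 0.

(** [hprim 1] is the variable x. Since the factorials are built into the coefficients, multiplying
    by it shifts them and brings out the factor [n], which also cancels the default [f 0] at
    [n = 0]. *)
Lemma hprim1M (R : comNzRingType) (f : hseries R) n :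
  (hprim 1 * f) n = f n.-1 *+ n.
Proof.
elim: n f => [|n IH] f; first exact: mul0r.
have -> : (hprim 1 * f) n.+1 = (1 * f) n + (hprim 1 * hder f) n by [].
by rewrite mul1r IH mulrS; case: n {IH}.
Qed.

Lemma hcoefM_congr (R : comNzRingType) (u f g : hseries R) n :
  (forall k, (k <= n)%N -> f k = g k) -> (u * f) n = (u * g) n.
Proof.
elim: n u f g => [|n IH] u f g fg; first by rewrite !hcoefM0 fg.
rewrite !hcoefMS; congr (_ + _); apply: IH => k kn; apply: fg; lia.
Qed.

(** A linear differential equation of first order determines its solution from the constant term:
    coefficient [n + 1] of [f] is coefficient [n] of [u * f], which involves [f] only up to [n]. *)
Lemma hder_uniq (R : comNzRingType) (u f g : hseries R) :
  f 0%N = g 0%N -> hder f = u * f -> hder g = u * g -> f = g.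
Proof.
move=> fg0 ff gg; apply/funext => n.
elim/ltn_ind: n => -[|n] IH //.
rewrite -[f n.+1]/(hder f n) -[g n.+1]/(hder g n) ff gg.
exact: hcoefM_congr.
Qed.

(** * Series in two variables *)

Notation bseries R := (hseries (hseries R)).

Definition dx (R : Type) (f : bseries R) : bseries R := hder f.
Definition dy (R : Type) (f : bseries R) : bseries R := fun w => hder (f w).

Lemma bseries_eq (R : Type) (f g : bseries R) :
  (forall w h, f w h = g w h) -> f = g.
Proof. by move=> fg; apply/funext => w; apply/funext => h. Qed.

Lemma bcoefD (R : comNzRingType) (f g : bseries R) w h :
  (f + g) w h = f w h + g w h.
Proof. by []. Qed.

Lemma dxM (R : comNzRingType) (f g : bseries R) :
  dx (f * g) = dx f * g + f * dx g.
Proof. by []. Qed.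

(** The outer index belongs to x, so the Leibniz rule for [dx] holds by computation. [dy] acts
    inside the coefficients in x; it commutes with [dx], which allows an induction on the outer
    index. *)
Lemma dyM (R : comNzRingType) (f g : bseries R) :
  dy (f * g) = dy f * g + f * dy g.
Proof.
apply/funext => w; elim: w f g => [|w IH] f g //.
have E : dy (f * g) w.+1 = dy (dx f * g) w + dy (f * dx g) w by [].
have E' : (dy f * g + f * dy g) w.+1 =
  (dy (dx f) * g) w + (dy f * dx g) w +
  ((dx f * dy g) w + (f * dy (dx g)) w) by [].
by rewrite E E' !IH !hcoefD addrACA.
Qed.

Lemma dxD (R : comNzRingType) (f g : bseries R) : dx (f + g) = dx f + dx g.
Proof. by []. Qed.
Lemma dyD (R : comNzRingType) (f g : bseries R) : dy (f + g) = dy f + dy g.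
Proof. by []. Qed.

Definition bconst (R : comNzRingType) (c : R) : bseries R := hconst (hconst c).
Definition bX (R : comNzRingType) : bseries R := hprim 1.
Definition bY (R : comNzRingType) : bseries R := hconst (hprim 1).
Arguments bX {R}.
Arguments bY {R}.

Lemma dx_const (R : comNzRingType) (c : R) : dx (bconst c) = 0.
Proof. by []. Qed.
Lemma dy_const (R : comNzRingType) (c : R) : dy (bconst c) = 0.
Proof. by apply: bseries_eq => -[|w]. Qed.
Lemma dx1 (R : comNzRingType) : dx (1 : bseries R) = 0.
Proof. by []. Qed.
Lemma dy1 (R : comNzRingType) : dy (1 : bseries R) = 0.
Proof. exact: dy_const. Qed.
Lemma dxX (R : comNzRingType) : dx (@bX R) = 1.
Proof. by []. Qed.
Lemma dyX (R : comNzRingType) : dy (@bX R) = 0.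
Proof. by apply: bseries_eq => -[|[|w]]. Qed.
Lemma dxY (R : comNzRingType) : dx (@bY R) = 0.
Proof. by []. Qed.
Lemma dyY (R : comNzRingType) : dy (@bY R) = 1.
Proof. by apply: bseries_eq => -[|w]. Qed.

Lemma bconstM (R : comNzRingType) (c : R) (f : bseries R) w h :
  (bconst c * f) w h = c * f w h.
Proof. by rewrite /bconst hconstM hconstM. Qed.

Lemma hcoefMn (R : comNzRingType) (f : hseries R) m n : (f *+ m) n = f n *+ m.
Proof. by elim: m => // m IH; rewrite !mulrS hcoefD IH. Qed.

Lemma bXM (R : comNzRingType) (f : bseries R) w h :
  (bX * f) w h = f w.-1 h *+ w.
Proof. by rewrite hprim1M hcoefMn. Qed.

Lemma bYM (R : comNzRingType) (f : bseries R) w h :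
  (bY * f) w h = f w h.-1 *+ h.
Proof. by rewrite hconstM hprim1M. Qed.

(** Congruence modulo total degree [n], used to replace the infinite sum over all trees by finite
    ones. *)
Definition eqdeg (R : Type) (n : nat) (f g : bseries R) : Prop :=
  forall w h, (w + h < n)%N -> f w h = g w h.

Lemma eqdegM (R : comNzRingType) n (f f' g g' : bseries R) :
  eqdeg n f f' -> eqdeg n g g' -> eqdeg n (f * g) (f' * g').
Proof.
elim: n f f' g g' => [|n IH] f f' g g' ff gg [|w] h wh //.
- case: h wh => [|h] wh; first by rewrite !hcoefM0 ff ?gg.
  rewrite -[LHS]/(dy (f * g) 0%N h) -[RHS]/(dy (f' * g') 0%N h) !dyM !bcoefD.
  by congr (_ + _); apply: IH => // i j ij; do ?[apply: ff|apply: gg]; lia.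
- rewrite -[LHS]/(dx (f * g) w h) -[RHS]/(dx (f' * g') w h) !dxM !bcoefD.
  by congr (_ + _); apply: IH => // i j ij; do ?[apply: ff|apply: gg]; lia.
Qed.

(* [tensor f g] is the product f(x) g(y) *)
Definition tensor (R : comNzRingType) (f g : hseries R) : bseries R :=
  fun w h => f w * g h.

Lemma tensorM (R : comNzRingType) (f f' g g' : hseries R) :
  tensor f g * tensor f' g' = tensor (f * f') (g * g').
Proof.
have E (a b c : hseries R) : tensor (a + b) c = tensor a c + tensor b c.
  by apply: bseries_eq => w h; exact: mulrDl.
have E' (a b c : hseries R) : tensor c (a + b) = tensor c a + tensor c b.
  by apply: bseries_eq => w h; exact: mulrDr.
apply: bseries_eq => w h.
elim: w f f' h g g' => [|w IH] f f' h g g'.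
  elim: h g g' => [|h IH] g g'; first exact: mulrACA.
  rewrite -[LHS]/(dy _ 0%N h) -[RHS]/(dy _ 0%N h) dyM bcoefD.
  rewrite -[dy (tensor f g)]/(tensor f (hder g)).
  rewrite -[dy (tensor f' g')]/(tensor f' (hder g')).
  by rewrite !IH -bcoefD -E'.
rewrite -[LHS]/(dx _ w h) -[RHS]/(dx _ w h) dxM bcoefD.
rewrite -[dx (tensor f g)]/(tensor (hder f) g).
rewrite -[dx (tensor f' g')]/(tensor (hder f') g').
by rewrite !IH -bcoefD -E.
Qed.

(** * Powers of 1 - t X Y *)

Definition rising (R : comNzRingType) (s : R) (k : nat) : R :=
  \prod_(0 <= j < k) (s + j%:R).

(* (1 - t X Y) ^ (- s) *)
Definition binv (R : comNzRingType) (t s : R) : bseries R :=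
  fun i j => if i == j then t ^+ i * i`!%:R * rising s i else 0.

Lemma risingS (R : comNzRingType) (s : R) k :
  rising s k.+1 = rising s k * (s + k%:R).
Proof. by rewrite /rising big_nat_recr. Qed.

(** This is (1 - t X Y) dG/dX = s t Y G for G = [binv t s], with the negative term moved to the
    right so that coefficients can be compared. *)
Lemma dx_binv_eq (R : comNzRingType) (t s : R) :
  dx (binv t s) = bconst t * (bX * (bY * dx (binv t s)))
     + bconst s * (bconst t * (bY * binv t s)).
Proof.
apply: bseries_eq => w h; rewrite bcoefD !bconstM bXM !bYM /dx /hder /binv.
case: h => [|h] /=; first by rewrite !mulr0n mul0rn !mulr0 addr0.
case: w => [|w] /=; rewrite !eqSS.
  case: h => [|h] /=; last by rewrite !mul0rn !mulr0 addr0.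
  by rewrite mulr0n risingS /rising big_nil; ring.
case: eqP => [<-|_]; last by rewrite !mul0rn !mulr0 addr0.
rewrite risingS factS natrM exprS.
set c := _ * rising s w.+1; rewrite -(mulr_natr (c *+ _)) -(mulr_natr c) /c.
by ring.
Qed.

Lemma dy_binv_eq (R : comNzRingType) (t s : R) :
  dy (binv t s) = bconst t * (bX * (bY * dy (binv t s)))
     + bconst s * (bconst t * (bX * binv t s)).
Proof.
(* By this symmetry the equation in Y is the equation in X at swapped indices. *)
have binvC i j : binv t s i j = binv t s j i.
  by rewrite /binv eq_sym; case: eqP => // ->.
apply: bseries_eq => w h.
have := congr1 (fun f : bseries R => f h w) (dx_binv_eq t s).
rewrite !bcoefD !bconstM !bXM !bYM /dx /dy /hder.
by rewrite (binvC h.+1) (binvC h w.-1) (binvC h.-1.+1) mulrnAC.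
Qed.

Lemma rising1 (R : comNzRingType) k : rising (1 : R) k = k`!%:R.
Proof.
elim: k => [|k IH]; first by rewrite /rising big_nil.
by rewrite risingS IH factS mulnC natrM -natr1 addrC.
Qed.

(** The geometric series: [binv t 1] inverts 1 - t X Y, which lets the preceding equations be solved
    for the derivatives. *)
Lemma binv1K (R : comNzRingType) (t : R) :
  binv t 1 * (1 - bconst t * (bX * bY)) = 1.
Proof.
suff E : binv t 1 = 1 + bconst t * (bX * (bY * binv t 1)).
  have -> : binv t 1 * (1 - bconst t * (bX * bY)) =
      binv t 1 - bconst t * (bX * (bY * binv t 1)) by ring.
  by rewrite {1}E addrK.
apply: bseries_eq => w h; rewrite bcoefD bconstM bXM bYM /binv.
case: w h => [|w] [|h] /=; rewrite ?mulr0n ?mul0rn ?mulr0 ?addr0 //.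
  by rewrite rising1 expr0 !mul1r.
rewrite eqSS -[(1 : bseries R) w.+1 h.+1]/(0 : R) add0r.
case: eqP => [<-|_]; last by rewrite !mul0rn mulr0.
rewrite !rising1 factS natrM exprS; set c := (X in _ = _ * (X *+ _ *+ _)).
by rewrite -(mulr_natr (c *+ _)) -(mulr_natr c) /c; ring.
Qed.

Lemma ring_unit_cancel (R : comNzRingType) (g d f a : R) :
  g * d = 1 -> d * f = a -> f = g * a.
Proof. by move=> gd <-; rewrite mulrA gd mul1r. Qed.

Lemma dx_binv (R : comNzRingType) (t s : R) :
  dx (binv t s) = bconst s * bconst t * bY * binv t 1 * binv t s.
Proof.
have E : (1 - bconst t * (bX * bY)) * dx (binv t s) =
    bconst s * (bconst t * (bY * binv t s)).
  have -> : (1 - bconst t * (bX * bY)) * dx (binv t s) =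
      dx (binv t s) - bconst t * (bX * (bY * dx (binv t s))) by ring.
  by rewrite {1}dx_binv_eq addrC addKr.
by rewrite (ring_unit_cancel (binv1K t) E); ring.
Qed.

Lemma dy_binv (R : comNzRingType) (t s : R) :
  dy (binv t s) = bconst s * bconst t * bX * binv t 1 * binv t s.
Proof.
have E : (1 - bconst t * (bX * bY)) * dy (binv t s) =
    bconst s * (bconst t * (bX * binv t s)).
  have -> : (1 - bconst t * (bX * bY)) * dy (binv t s) =
      dy (binv t s) - bconst t * (bX * (bY * dy (binv t s))) by ring.
  by rewrite {1}dy_binv_eq addrC addKr.
by rewrite (ring_unit_cancel (binv1K t) E); ring.
Qed.

Lemma binv_x0 (R : comNzRingType) (t s : R) : binv t s 0%N = 1.
Proof.
apply/funext => -[|h] //; rewrite /binv /= /rising big_nil.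
by rewrite expr0 !mul1r.
Qed.

Lemma bconstD (R : comNzRingType) (a b : R) :
  bconst (a + b) = bconst a + bconst b.
Proof. by apply: bseries_eq => -[|w] [|h] //=; rewrite bcoefD /= ?addr0. Qed.

(** Both sides equal 1 at X = 0 and satisfy the same linear differential equation in X. *)
Lemma binvD (R : comNzRingType) (t a b : R) :
  binv t a * binv t b = binv t (a + b).
Proof.
apply: (hder_uniq (u := bconst (a + b) * bconst t * bY * binv t 1)).
- by rewrite hcoefM0 !binv_x0 mul1r.
- rewrite -[LHS]/(dx _) dxM !dx_binv bconstD; ring.
- exact: dx_binv.
Qed.

(** * The exponential change of variables *)

(** The derivative of exp (a x) f(exp x - 1) is exp (a x) times (a f + (1 + X) f') at X = exp x - 1,
    because exp x = 1 + X. *)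
Definition Dx (R : comNzRingType) (a : R) (f : bseries R) : bseries R :=
  bconst a * f + (1 + bX) * dx f.
Definition Dy (R : comNzRingType) (b : R) (f : bseries R) : bseries R :=
  bconst b * f + (1 + bY) * dy f.

Lemma dxDy (R : comNzRingType) (b : R) f : dx (Dy b f) = Dy b (dx f).
Proof.
rewrite /Dy dxD !dxM dxD dx_const dx1 dxY.
rewrite -[dx (dy f)]/(dy (dx f)); ring.
Qed.

Lemma dyDx (R : comNzRingType) (a : R) f : dy (Dx a f) = Dx a (dy f).
Proof.
rewrite /Dx dyD !dyM dyD dy_const dy1 dyX.
rewrite -[dy (dx f)]/(dx (dy f)); ring.
Qed.

Lemma DxDy (R : comNzRingType) (a b : R) f : Dx a (Dy b f) = Dy b (Dx a f).
Proof.
rewrite {1}/Dx dxDy {1}[in RHS]/Dy dyDx /Dx /Dy.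
rewrite -[dx (dy f)]/(dy (dx f)); ring.
Qed.

(* The exponential change of variables: [expsub a b f] is
   exp (a x + b y) f(exp x - 1, exp y - 1), so that differentiating it in x
   amounts to applying [Dx a] to f. *)
Definition expsub (R : comNzRingType) (a b : R) (f : bseries R) : bseries R :=
  fun w h => iter w (Dx a) (iter h (Dy b) f) 0%N 0%N.

Lemma dx_expsub (R : comNzRingType) (a b : R) f :
  dx (expsub a b f) = expsub a b (Dx a f).
Proof.
have C h : iter h (Dy b) (Dx a f) = Dx a (iter h (Dy b) f).
  by elim: h => //= h ->; rewrite DxDy.
by apply: bseries_eq => w h; rewrite /expsub C -iterSr.
Qed.

Lemma dy_expsub (R : comNzRingType) (a b : R) f :
  dy (expsub a b f) = expsub a b (Dy b f).
Proof. by apply: bseries_eq => w h; rewrite /expsub -iterSr. Qed.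

Lemma DxD (R : comNzRingType) (a : R) f g : Dx a (f + g) = Dx a f + Dx a g.
Proof. rewrite /Dx dxD; ring. Qed.
Lemma DyD (R : comNzRingType) (a : R) f g : Dy a (f + g) = Dy a f + Dy a g.
Proof. rewrite /Dy dyD; ring. Qed.

Lemma expsubD (R : comNzRingType) (a b : R) f g :
  expsub a b (f + g) = expsub a b f + expsub a b g.
Proof.
apply: bseries_eq => w h; elim: w h f g => [|w IH] h f g.
  elim: h f g => // h IH f g.
  rewrite -[LHS]/(dy (expsub a b (f + g)) 0%N h).
  rewrite -[RHS]/(dy (expsub a b f + expsub a b g) 0%N h).
  by rewrite dyD !dy_expsub DyD IH.
rewrite -[LHS]/(dx (expsub a b (f + g)) w h).
rewrite -[RHS]/(dx (expsub a b f + expsub a b g) w h).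
by rewrite dxD !dx_expsub DxD IH.
Qed.

(** Exponents add: [Dx (a + a')] obeys a Leibniz rule on products, with [Dx a] on one factor and
    [Dx a'] on the other, and similarly in y. So both sides have matching derivatives. *)
Lemma expsubM (R : comNzRingType) (a b a' b' : R) f g :
  expsub (a + a') (b + b') (f * g) = expsub a b f * expsub a' b' g.
Proof.
apply: bseries_eq => w h; elim: w h f g => [|w IH] h f g.
  elim: h f g => // h IH f g.
  rewrite -[LHS]/(dy (expsub (a + a') (b + b') (f * g)) 0%N h).
  rewrite -[RHS]/(dy (expsub a b f * expsub a' b' g) 0%N h).
  rewrite dyM !dy_expsub bcoefD -!IH -bcoefD -expsubD.
  by congr (expsub _ _ _ _ _); rewrite /Dy dyM bconstD; ring.
rewrite -[LHS]/(dx (expsub (a + a') (b + b') (f * g)) w h).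
rewrite -[RHS]/(dx (expsub a b f * expsub a' b' g) w h).
rewrite dxM !dx_expsub bcoefD -!IH -bcoefD -expsubD.
by congr (expsub _ _ _ _ _); rewrite /Dx dxM bconstD; ring.
Qed.

Lemma expsub_const (R : comNzRingType) (c : R) : expsub 0 0 (bconst c) = bconst c.
Proof.
have b0 : bconst (0 : R) = 0 by apply: bseries_eq => -[|w] [].
have E f : dx f = 0 -> Dx (0 : R) f = 0 by move=> f0; rewrite /Dx f0 b0; ring.
have E' f : dy f = 0 -> Dy (0 : R) f = 0 by move=> f0; rewrite /Dy f0 b0; ring.
have Z w h : expsub 0 0 (0 : bseries R) w h = 0.
  have := expsubD 0 0 (0 : bseries R) 0; rewrite addr0 => /eqP.
  by rewrite -subr_eq0 opprD addrA subrr sub0r oppr_eq0 => /eqP ->.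
apply: bseries_eq => -[|w] h.
  case: h => // h; rewrite -[LHS]/(dy (expsub 0 0 (bconst c)) 0%N h).
  by rewrite dy_expsub E' ?dy_const // Z.
rewrite -[LHS]/(dx (expsub 0 0 (bconst c)) w h).
by rewrite dx_expsub E ?dx_const // Z.
Qed.

(** exp x = 1 + X and exp y = 1 + Y. This brings F1 to the form without exponential factors, in
    which U and W are written. *)
Lemma expsub11 (R : comNzRingType) (f : bseries R) :
  expsub 1 1 f = expsub 0 0 ((1 + bX) * (1 + bY) * f).
Proof.
have b0 : bconst (0 : R) = 0 by apply: bseries_eq => -[|w] [].
have b1 : bconst (1 : R) = 1 by [].
apply: bseries_eq => w h; elim: w h f => [|w IH] h f.
  elim: h f => [|h IH] f.
    rewrite /expsub /= !hcoefM0 hcoefD -[RHS]/((1 + 0) * (1 + 0) * f 0%N 0%N).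
    by rewrite addr0 !mul1r.
  rewrite -[LHS]/(dy (expsub 1 1 f) 0%N h) dy_expsub IH.
  rewrite -[RHS]/(dy (expsub _ _ _) 0%N h) dy_expsub.
  congr (expsub _ _ _ _ _); rewrite /Dy !dyM !dyD dyX dyY dy1 b0 b1; ring.
rewrite -[LHS]/(dx (expsub 1 1 f) w h) dx_expsub IH.
rewrite -[RHS]/(dx (expsub _ _ _) w h) dx_expsub.
congr (expsub _ _ _ _ _); rewrite /Dx !dxM !dxD dxX dxY dx1 b0 b1; ring.
Qed.

(** * Stirling numbers as coefficients *)

(** Shifted Stirling numbers of the second kind: for fixed [k], their exponential generating
    function in [n] is exp (a x) (exp x - 1)^k / k!. *)
Fixpoint stirling (R : comNzRingType) (a : R) (n k : nat) : R :=
  if n is m.+1 then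
    (a + k%:R) * stirling a m k + (if k is j.+1 then stirling a m j else 0)
  else (k == 0%N)%:R.

Lemma stirling_small (R : comNzRingType) (a : R) n k :
  (n < k)%N -> stirling a n k = 0.
Proof.
elim: n k => [|n IH] [|k] //= nk; rewrite !IH ?mulr0 ?addr0 //; lia.
Qed.

(* [op] stands for the coefficient action of [Dx a] and [Dy a] *)
Lemma iter_stirling (R : comNzRingType) (a : R) (op : hseries R -> hseries R)
    (f : hseries R) n :
  (forall g k, op g k = (a + k%:R) * g k + g k.+1) ->
  iter n op f 0%N = \sum_(k < n.+1) stirling a n k * f k.
Proof.
move=> opE; elim: n f => [|n IH] f; first by rewrite big_ord1 mul1r.
rewrite iterSr IH.
under eq_bigr do rewrite opE mulrDr.
rewrite big_split /=; under [RHS]eq_bigr do rewrite mulrDl.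
rewrite big_split /=; congr (_ + _).
  rewrite [RHS]big_ord_recr /= stirling_small // mulr0 mul0r addr0.
  by apply: eq_bigr => i _; rewrite mulrCA mulrA.
by rewrite [RHS]big_ord_recl /= mul0r add0r.
Qed.

Lemma DxE (R : comNzRingType) (a : R) f i j :
  Dx a f i j = (a + i%:R) * f i j + f i.+1 j.
Proof.
rewrite /Dx mulrDl mul1r !bcoefD bconstM bXM mulrDl mulr_natl /dx /hder.
by case: i => [|i] /=; rewrite -addrA; congr (_ + _); rewrite addrC.
Qed.

Lemma DyE (R : comNzRingType) (a : R) f i j :
  Dy a f i j = (a + j%:R) * f i j + f i j.+1.
Proof.
rewrite /Dy mulrDl mul1r !bcoefD bconstM bYM mulrDl mulr_natl /dy /hder.
by case: j => [|j] /=; rewrite -addrA; congr (_ + _); rewrite addrC.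
Qed.

Lemma expsubE (R : comNzRingType) (a b : R) f w h :
  expsub a b f w h = \sum_(i < w.+1) \sum_(j < h.+1)
    stirling a w i * (stirling b h j * f i j).
Proof.
pose opx (u : hseries R) : hseries R := fun k => (a + k%:R) * u k + u k.+1.
pose opy (u : hseries R) : hseries R := fun k => (b + k%:R) * u k + u k.+1.
have xE n (g : bseries R) i :
    iter n (Dx a) g i 0%N = iter n opx (fun k => g k 0%N) i.
  by elim: n i => // n IH i; rewrite !iterS DxE /opx -!IH.
have yE n i j : iter n (Dy b) f i j = iter n opy (f i) j.
  by elim: n j => // n IH j; rewrite !iterS DyE /opy -!IH.
rewrite /expsub xE (@iter_stirling _ a) //; apply: eq_bigr => i _.
by rewrite -mulr_sumr yE (@iter_stirling _ b).
Qed.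

(** [binv] is supported on the diagonal, so the double sum of [expsubE] collapses. *)
Lemma expsub_binv (R : comNzRingType) (t s a b : R) w h :
  expsub a b (binv t s) w h = \sum_(k < w.+1)
    t ^+ k * (k`!%:R * rising s k * stirling a w k * stirling b h k).
Proof.
rewrite expsubE; apply: eq_bigr => i _.
case: (leqP i h) => ih; last first.
  rewrite (@stirling_small _ b h i) // !mulr0 big1 // => j _.
  rewrite /binv; case: eqP => [ij|]; last by rewrite !mulr0.
  by have := ltn_ord j; rewrite -[nat_of_ord j]ij ltnS leqNgt ih.
have ih' : (i < h.+1)%N by [].
rewrite (bigD1 (Ordinal ih')) //= big1 ?addr0; last first.
  move=> j /eqP ji; rewrite /binv; case: eqP => [ij|]; last by rewrite !mulr0.
  by case: ji; apply/val_inj.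
by rewrite /binv eqxx; ring.
Qed.

(** * Set partitions *)

Lemma partition_notin (T : finType) (P : {set {set T}}) (D B : {set T}) b :
  partition P D -> b \notin D -> b \in B -> B \notin P.
Proof.
by move=> PD bD bB; apply/negP => /(partitionS PD)/subsetP/(_ b bB); apply/negP.
Qed.

(* Here x.2 is a block of x.1, or the empty set when b becomes a block alone. *)
Definition part_insert (T : finType) (b : T) (x : {set {set T}} * {set T}) :=
  (b |: x.2) |: (x.1 :\ x.2).

Definition part_remove (T : finType) (b : T) (P : {set {set T}}) :=
  let C := pblock P b :\ b in
  (if C == set0 then P :\ pblock P b else C |: (P :\ pblock P b), C).

(** Together with [part_removeP], this identifies the partitions of [b |: A] with the partitions of
    [A] in which either a block or the empty set is chosen. *)
Lemma part_insertP (T : finType) (A : {set T}) (b : T) P C :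
  b \notin A -> partition P A -> C \in set0 |: P ->
  partition (part_insert b (P, C)) (b |: A) /\
  part_remove b (part_insert b (P, C)) = (P, C).
Proof.
move=> bA PA CP.
have CA : C \subset A.
  by case/setU1P: CP => [->|/(partitionS PA)//]; exact: sub0set.
have bC : b \notin C by apply: contra bA => /(subsetP CA).
have PC : partition (P :\ C) (A :\: C).
  case/setU1P: CP => [->|CP]; last exact: partitionD1.
  have /and3P[_ _ P0] := PA.
  by rewrite setD0 (setDidPl _) // disjoint_sym disjoints1.
have bCP : b |: C \notin P :\ C.
  apply: (partition_notin PC (b := b)); rewrite ?setU11 //.
  by rewrite inE negb_and negbK (negPf bA) orbT.
have PI : partition (part_insert b (P, C)) (b |: A).
  have -> : b |: A = (b |: C) :|: (A :\: C).
    by rewrite -setUA -{1}(setID A C) (setIidPr CA).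
  apply: partitionU1 => //; first by apply/set0Pn; exists b; rewrite setU11.
  rewrite disjoint_sym disjoints_subset; apply/subsetP => x.
  rewrite !inE => /andP[xC xA]; rewrite negb_or xC andbT.
  by apply: contraNneq bA => <-.
split=> //; rewrite /part_remove.
have -> : pblock (part_insert b (P, C)) b = b |: C.
  by apply: def_pblock; rewrite ?setU11 //; case/and3P: PI.
have -> : (b |: C) :\ b = C by rewrite setU1K.
have -> : part_insert b (P, C) :\ (b |: C) = P :\ C by rewrite /part_insert /= setU1K.
congr (_, _); case: eqP => [C0|/eqP C0].
  have /and3P[_ _ P0] := PA.
  by rewrite C0 (setDidPl _) // disjoint_sym disjoints1.
by case/setU1P: CP => [C0'|CP]; [rewrite C0' eqxx in C0 | exact: setD1K].
Qed.

Lemma part_removeP (T : finType) (A : {set T}) (b : T) Q :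
  b \notin A -> partition Q (b |: A) ->
  [/\ partition (part_remove b Q).1 A,
      (part_remove b Q).2 \in set0 |: (part_remove b Q).1
    & part_insert b (part_remove b Q) = Q].
Proof.
move=> bA QA; have /and3P[/eqP cQ tQ Q0] := QA.
have bQ : b \in cover Q by rewrite cQ setU11.
have BQ : pblock Q b \in Q by rewrite pblock_mem.
have bB : b \in pblock Q b by rewrite mem_pblock.
rewrite /part_remove; move: (pblock Q b) BQ bB => B BQ bB.
have BA := partitionS QA BQ.
have QB := partitionD1 QA BQ.
set C := B :\ b.
have bC : b |: C = B by rewrite setD1K.
have CA : A = C :|: ((b |: A) :\: B).
  apply/setP => x; rewrite !inE; have := subsetP BA x; rewrite !inE.
  case: eqP => [->|_] /=; first by rewrite bB (negPf bA).
  by case: (x \in B) => //= ->.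
case: eqP => [C0|/eqP C0] /=.
  split; [|by rewrite C0 setU11|].
    by rewrite CA C0 set0U.
  rewrite /part_insert /= bC C0 [_ :\ set0](setDidPl _) ?setD1K //.
  by rewrite disjoint_sym disjoints1 !inE negb_and Q0 orbT.
have CB : [disjoint C & (b |: A) :\: B].
  rewrite disjoint_sym disjoints_subset; apply/subsetP => x.
  by rewrite !inE => /andP[/negPf-> _]; rewrite andbF.
have CQ : C \notin Q :\ B.
  have [x xC] := set0Pn _ C0.
  apply: (partition_notin QB (b := x)) => //.
  by apply/negP => xQ; move/pred0P: CB => /(_ x); rewrite /= xC xQ.
split; [|by rewrite !inE eqxx orbT|].
  by rewrite [X in partition _ X]CA; exact: partitionU1.
by rewrite /part_insert /= setU1K // bC setD1K.
Qed.

Lemma sum_partition_setU1 (R : comNzRingType) (T : finType) (A : {set T}) (b : T)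
    (g : {set {set T}} -> R) :
  b \notin A ->
  \sum_(Q | partition Q (b |: A)) g Q =
  \sum_(P | partition P A) \sum_(C in set0 |: P) g (part_insert b (P, C)).
Proof.
move=> bA; rewrite pair_big_dep /=.
rewrite (reindex_onto (part_insert b) (part_remove b)) /=; last first.
  by move=> Q QA; case: (part_removeP bA QA).
apply: eq_big => [[P C]|[P C] _] //=; apply/andP/andP => [[QA /eqP QE]|[PA CP]].
  by case: (part_removeP bA QA) => H1 H2 _; rewrite QE in H1 H2.
by have [-> ->] := part_insertP bA PA CP.
Qed.

(** Induction by removing an element [b] other than [a]. Either [b] is a block alone, or it joins
    the block of [a], with a factor [q], or it joins one of the [p - 1] other blocks. This is the
    recurrence of [stirling] at [k = p - 1]. *)
Lemma sum_partition_stirling (R : comNzRingType) (q : R) (T : finType)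
    (A : {set T}) (a : T) (p : nat) : a \in A ->
  \sum_(P : {set {set T}} | partition P A && (#|P| == p))
      q ^+ (#|pblock P a|).-1 = if p is k.+1 then stirling q #|A|.-1 k else 0.
Proof.
move En : #|A|.-1 => n; elim: n A p En => [|n IH] A p An aA.
  have /eqP A1 : A == [set a].
    by rewrite eq_sym eqEcard sub1set aA cards1; move: An; case: #|A| => [|[]].
  have PE (P : {set {set T}}) : partition P A = (P == [set [set a]]).
    apply/idP/eqP => [PA|->]; last first.
      rewrite /partition /cover !big_set1 A1 eqxx /= trivIset1 /=.
      by rewrite inE eq_sym; apply/set0Pn; exists a; rewrite inE.
    have /and3P[/eqP cP tP P0] := PA.
    have aP : [set a] \in P.
      have aB : pblock P a \in P by rewrite pblock_mem // cP.
      suff <- : pblock P a = [set a] by [].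
      apply/eqP; rewrite eqEsubset sub1set mem_pblock cP aA andbT -A1.
      exact: partitionS PA aB.
    apply/setP => B; rewrite inE; apply/idP/eqP => [BP|->//].
    have /set0Pn[x xB] : B != set0 by apply: contraNneq P0 => <-.
    have := partitionS PA BP; rewrite A1 subset1.
    by case/orP=> /eqP // B0; rewrite B0 inE in xB.
  under eq_bigl do rewrite PE.
  case: p => [|p].
    by rewrite big1 // => P /andP[/eqP->]; rewrite cards1.
  case: p => [|p] /=; last first.
    by rewrite big1 // => P /andP[/eqP->]; rewrite cards1.
  rewrite (big_pred1 [set [set a]]) => [|P].
    by rewrite (def_pblock (B := [set a])) ?trivIset1 ?inE // cards1.
  rewrite /=; case: (P =P _) => [->|//]; exact/eqP/cards1.
have [b bA ba] : exists2 b, b \in A & b != a.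
  have : (0 < #|A :\ a|)%N by move: An; rewrite (cardsD1 a) aA; case: #|_|.
  by case/card_gt0P => b; rewrite !inE => /andP[]; exists b.
have bA' : b \notin A :\ b by rewrite setD11.
have aA' : a \in A :\ b by rewrite !inE eq_sym ba.
have An' : #|A :\ b|.-1 = n by move: An; rewrite (cardsD1 b) bA add1n /= => ->.
rewrite big_mkcondr /= -(setD1K bA) sum_partition_setU1 //.
have PE P : partition P (A :\ b) -> \sum_(C in set0 |: P)
    (if #|part_insert b (P, C)| == p
     then q ^+ (#|pblock (part_insert b (P, C)) a|).-1 else 0) =
    (if #|P|.+1 == p then q ^+ (#|pblock P a|).-1 else 0) +
    (if #|P| == p then (q + p.-1%:R) * q ^+ (#|pblock P a|).-1 else 0).
  move=> PA; have /and3P[/eqP cP tP P0] := PA.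
  have cI C : C \in set0 |: P -> #|part_insert b (P, C)| = (#|P| + (C == set0))%N.
    move=> CP; rewrite /part_insert /= cardsU1.
    have -> : b |: C \notin P :\ C.
      rewrite inE negb_and (partition_notin PA bA') ?setU11 // orbT //.
    move: CP; rewrite in_setU1 (cardsD1 C P).
    by case: eqP => [->|_] /=; [rewrite (negPf P0) addnC | move=> ->; rewrite addn0].
  have pI C : C \in set0 |: P -> pblock (part_insert b (P, C)) a =
      if a \in C then b |: C else pblock P a.
    move=> CP; have [QA _] := part_insertP bA' PA CP.
    case/and3P: QA => _ tQ _; apply: def_pblock => //.
      rewrite /part_insert /= !inE; case: ifP => [|/negbT aC]; first by rewrite eqxx.
      rewrite pblock_mem ?cP // andbT; apply/orP; right.
      by apply: contraNneq aC => <-; rewrite mem_pblock cP.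
    by case: ifP => [aC|_]; rewrite ?inE ?aC ?orbT // mem_pblock cP.
  rewrite big_setU1 //= cI ?setU11 // eqxx addn1 pI ?setU11 // inE.
  congr (_ + _).
  rewrite (eq_bigr (fun C : {set T} => if #|P| == p
    then q ^+ (#|if a \in C then b |: C else pblock P a|).-1 else 0)); last first.
    move=> C CP; have CP' : C \in set0 |: P by rewrite in_setU1 CP orbT.
    rewrite cI // pI //; case: (C =P set0) CP => [->|]; first by rewrite (negPf P0).
    by rewrite addn0.
  case: eqP => [Pp|_]; last by rewrite big1.
  have aB : a \in pblock P a by rewrite mem_pblock cP.
  have BP : pblock P a \in P by rewrite pblock_mem // cP.
  (* Only the choice of the block of [a] changes the weight. *)
  rewrite (big_setD1 (pblock P a)) //= aB.
  have -> : (#|b |: pblock P a|.-1 = (#|pblock P a|.-1).+1)%N.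
    rewrite cardsU1.
    have -> : b \notin pblock P a.
      by apply: contra bA' => /(subsetP (partitionS PA BP)).
    by rewrite (cardsD1 a) aB.
  rewrite mulrDl exprS; congr (_ + _).
  rewrite (eq_bigr (fun=> q ^+ (#|pblock P a|).-1)) => [|C]; last first.
    rewrite !inE => /andP[CB CP]; case: ifP => // aC.
    by rewrite (def_pblock tP CP aC) eqxx in CB.
  by rewrite sumr_const mulr_natl -Pp (cardsD1 (pblock P a) P) BP.
rewrite (eq_bigr _ PE) big_split /= -!big_mkcondr /= -mulr_sumr IH //.
case: p {PE} => [|p].
  by rewrite mulr0 addr0 big1 // => P /andP[].
rewrite addrC; congr (_ + _).
by rewrite -[LHS]/(\sum_(P | partition P (A :\ b) && (#|P| == p)) _) IH.
Qed.

Lemma S2q_stirling (R : comNzRingType) (q : R) n p :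
  S2q q n.+1 p.+1 = stirling q n p.
Proof. by rewrite /S2q sum_partition_stirling ?inE // cardsT card_ord. Qed.

(** * Generating functions of the trees *)

Lemma lab_count_perm s1 s2 n : uniq s1 -> perm_eq s1 s2 ->
  lab_count s1 n = lab_count s2 n.
Proof.
elim: n s1 s2 => [|n IH] s1 s2 u1 s12.
  by rewrite /= -!size_eq0 (perm_size s12).
have u2 : uniq s2 by rewrite -(perm_uniq s12).
rewrite !lab_countS (perm_big _ s12) /=; apply: eq_big => v; first exact: perm_all.
move=> _; apply: IH; first exact: rem_uniq.
by rewrite !rem_filter // perm_filter.
Qed.

Lemma lab_count_map_cons b s n : uniq s ->
  lab_count (map (cons b) s) n = lab_count s n.
Proof.
elim: n s => [|n IH] s us; first by case: s us.
rewrite !lab_countS big_map; apply: eq_big => v.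
  rewrite /maximal_in all_map; apply: eq_all => u /=.
  by rewrite /proper_ancestor /= !eqseq_cons eqxx.
move=> _; rewrite !rem_filter ?(map_inj_uniq (@cons_inj b)) //.
rewrite filter_map (eq_filter (a2 := predC1 v)).
  by apply: IH; exact: filter_uniq.
by move=> u /=; rewrite eqseq_cons eqxx.
Qed.

(** A single term by [lab_count_size]: the number of orderings times x^n / n! for [n = size s]. *)
Definition lab_series (R : comNzRingType) (s : seq vertex) : hseries R :=
  fun n => (lab_count s n)%:R.
Arguments lab_series R s : clear implicits.

Lemma hder_lab_series (R : comNzRingType) s :
  hder (lab_series R s) = \sum_(v <- s | maximal_in s v) lab_series R (rem v s).
Proof.
by apply/funext => n; rewrite hcoef_sum /hder /lab_series lab_countS natr_sum.
Qed.

Definition incomparable (u v : vertex) := ~~ prefix u v && ~~ prefix v u.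

(** The first vertex of an ordering is a maximal vertex of [s1] or of [s2], and removing it
    differentiates the corresponding factor: this is the Leibniz rule. *)
Lemma lab_series_cat (R : comNzRingType) s1 s2 : uniq s1 -> uniq s2 ->
  {in s1 & s2, forall u v, incomparable u v} ->
  lab_series R (s1 ++ s2) = lab_series R s1 * lab_series R s2.
Proof.
move=> u1 u2 inc; apply/funext => n.
elim: n s1 s2 u1 u2 inc => [|n IH] s1 s2 u1 u2 inc.
  by rewrite hcoefM0 /lab_series /= -natrM mulnb; case: s1 u1 inc.
have disj u : u \in s1 -> u \in s2 -> False.
  by move=> us1 us2; have := inc u u us1 us2; rewrite /incomparable prefix_refl.
have u12 : uniq (s1 ++ s2).
  by rewrite cat_uniq u1 u2 andbT; apply/hasPn => v vs2; apply/negP => /disj.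
rewrite hcoefMS -[LHS]/(hder _ n) !hder_lab_series mulr_suml mulr_sumr.
rewrite !hcoef_sum big_cat /= big_seq_cond [X in _ + X]big_seq_cond.
rewrite [in RHS]big_seq_cond [X in _ = _ + X]big_seq_cond; congr (_ + _).
  apply: eq_big => [v|v /andP[vs _]].
    apply: andb_id2l => vs; rewrite /maximal_in all_cat andbC.
    suff -> : all (fun u => ~~ proper_ancestor u v) s2 by [].
    apply/allP => u us; have /andP[_] := inc v u vs us.
    by apply: contra => /andP[].
  rewrite -IH ?rem_uniq //; last by move=> x y /mem_rem; exact: inc.
  rewrite !rem_filter // filter_cat [X in _ ++ X](_ : _ = s2) //.
  by apply/all_filterP/allP => u us /=; apply/eqP => uv; apply: (disj u); rewrite // uv.
apply: eq_big => [v|v /andP[vs _]].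
  apply: andb_id2l => vs; rewrite /maximal_in all_cat.
  suff -> : all (fun u => ~~ proper_ancestor u v) s1 by [].
  apply/allP => u us; have /andP[+ _] := inc u v us vs.
  by apply: contra => /andP[].
rewrite -IH ?rem_uniq //; last by move=> x y xs /mem_rem; exact: inc.
rewrite !rem_filter // filter_cat [X in X ++ _](_ : _ = s1) //.
by apply/all_filterP/allP => u us /=; apply/eqP => uv; apply: (disj u); rewrite // uv.
Qed.

(** The common ancestor must come first, so the derivative of the left side is [lab_series R s]. *)
Lemma lab_series_root (R : comNzRingType) r s : uniq (r :: s) ->
  all (proper_ancestor r) s -> lab_series R (r :: s) = hprim (lab_series R s).
Proof.
move=> us /allP rs; apply/funext => -[|n] //.
have Mr : maximal_in (r :: s) r.
  apply/allP => u; rewrite inE => /orP[/eqP->|/rs]; rewrite /proper_ancestor.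
    by rewrite eqxx.
  move=> /andP[ru pru]; apply/negP => /andP[_ pur].
  move/prefixP: pru pur ru => [t1 ->] /prefixP[t2 /(congr1 size)].
  by rewrite !size_cat; case: t1 => [|x t1]; rewrite ?cats0 ?eqxx //=; lia.
rewrite /lab_series lab_countS big_cons Mr big_seq_cond big_pred0 => [|v].
  by rewrite /= eqxx addn0.
apply/andP => -[/rs rv]; rewrite /maximal_in /= => /andP[/negP[]].
exact: rv.
Qed.

(** Contribution of a subtree hung as a [d]-child: its root is then a [d]-child too and lies above
    the others, hence the integration. *)
Definition chain_series (R : comNzRingType) (d : bool) (B : bintree) : hseries R :=
  if B is bt_empty then 1 else hprim (lab_series R (children d B)).
Arguments chain_series R d B : clear implicits.

Lemma lab_series_nil (R : comNzRingType) : lab_series R [::] = 1.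
Proof. by apply/funext => -[|n] //; rewrite /lab_series lab_countS big_nil. Qed.

Lemma children_node d l r :
  perm_eq (children d (bt_node l r))
    ((if (if d then r else l) is bt_empty then [::]
      else [:: d] :: map (cons d) (children d (if d then r else l)))
     ++ map (cons (~~ d)) (children d (if d then l else r))).
Proof.
have uc b B : uniq (map (cons b) (children d B)).
  by rewrite (map_inj_uniq (@cons_inj b)) children_uniq.
apply: uniq_perm; first exact: children_uniq.
  rewrite cat_uniq uc andbT; apply/andP; split.
    case: (if d then r else l) => // l' r'.
    rewrite cons_uniq uc andbT mem_map_cons eqxx /=.
    by rewrite mem_children.
  apply/hasPn => x /mapP[y _ ->]; case: (if d then r else l) => // l' r'.
  by rewrite /= in_cons mem_map_cons eqseq_cons; case: (d).
move=> v; rewrite mem_children mem_cat.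
case: v => [|b v] /=.
  by rewrite nil_map_cons; case: (if d then r else l) => // *; rewrite inE nil_map_cons.
rewrite mem_vertices_node mem_map_cons mem_children.
have -> : (last b v == d) = (if v == [::] then b == d else last d v == d).
  by case: v.
have lE c : (last c v == d) = (if v == [::] then c == d else last d v == d).
  by case: v.
have [->|bd] := eqVneq b d.
  have -> : (d == ~~ d) = false by case: (d).
  rewrite orbF; case: (if d then r else l) => [|l' r']; first by rewrite andbF.
  rewrite [in RHS]in_cons mem_map_cons eqseq_cons eqxx mem_children /=.
  by case: v lE.
have -> : b == ~~ d by case: (b) (d) bd => [] [].
have -> : (if b then r else l) = (if d then l else r).
  by case: (b) (d) bd => [] [].
have -> : (b :: v \in match (if d then r else l) with
    | bt_empty => [::]
    | bt_node _ _ => [:: d] :: map (cons d) (children d (if d then r else l))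
    end) = false.
  case: (if d then r else l) => // l' r'.
  by rewrite [LHS]in_cons mem_map_cons eqseq_cons (negPf bd).
by case: eqP.
Qed.

(** The [d]-children on the two sides of the root are incomparable, hence the product; on the side
    of [d] they include [[:: d]], an ancestor of all the others there. *)
Lemma lab_series_node (R : comNzRingType) d l r :
  lab_series R (children d (bt_node l r)) =
    chain_series R d (if d then r else l) *
    lab_series R (children d (if d then l else r)).
Proof.
have E b B : lab_series R (map (cons b) (children d B)) = lab_series R (children d B).
  by apply/funext => n; rewrite /lab_series lab_count_map_cons ?children_uniq.
have uc b B : uniq (map (cons b) (children d B)).
  by rewrite (map_inj_uniq (@cons_inj b)) children_uniq.
have -> : lab_series R (children d (bt_node l r)) = lab_series R
    ((if (if d then r else l) is bt_empty then [::]
      else [:: d] :: map (cons d) (children d (if d then r else l)))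
     ++ map (cons (~~ d)) (children d (if d then l else r))).
  apply/funext => n; rewrite /lab_series (lab_count_perm n _ (children_node d l r)) //.
  exact: children_uniq.
case: (if d then r else l) => [|l' r']; first by rewrite /= mul1r E.
have ur : uniq ([:: d] :: map (cons d) (children d (bt_node l' r'))).
  by rewrite cons_uniq uc andbT mem_map_cons eqxx mem_children.
rewrite lab_series_cat //; last first.
  move=> u v; rewrite inE => /orP[/eqP->|/mapP[x _ ->]] /mapP[y _ ->];
  by rewrite /incomparable !prefix_cons; case: (d).
rewrite E lab_series_root //; first by rewrite E.
apply/allP => v /mapP[x]; rewrite mem_children => /and3P[x0 _ _] ->.
by rewrite /proper_ancestor eqseq_cons eqxx /= eq_sym x0 eqxx; case: (x).
Qed.

(** * Decomposition of the trees at the root *)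

(** Number of new hooks in a subtree that continues a leftmost branch: the vertices of this branch
    belong to a hook started above, so only the right subtrees along it count. *)
Fixpoint hook_left (B : bintree) : nat :=
  if B is bt_node l r then (hook_number r + hook_left l)%N else 0%N.
Fixpoint hook_right (B : bintree) : nat :=
  if B is bt_node l r then (hook_number l + hook_right r)%N else 0%N.

Lemma hook_number_node l r :
  hook_number (bt_node l r) = (hook_left l + hook_right r).+1.
Proof.
(* Names for the two inner loops of [hooks_from], which the induction must treat together with
   it. *)
pose al := fix along_left (u : vertex) (t : bintree) : seq (seq vertex) :=
  if t is bt_node l r then
    hooks_from (rcons u dright) r ++ along_left (rcons u dleft) l
  else [::].
pose ar := fix along_right (u : vertex) (t : bintree) : seq (seq vertex) :=
  if t is bt_node l r then
    hooks_from (rcons u dleft) l ++ along_right (rcons u dright) r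
  else [::].
have E B : [/\ forall v, size (hooks_from v B) = hook_number B,
    forall v, size (al v B) = hook_left B & forall v, size (ar v B) = hook_right B].
  elim: B => [|l' [hl al_l ar_l] r' [hr al_r ar_r]]; first by [].
  split=> v.
  - rewrite /hook_number /hooks.
    rewrite -[hooks_from v _]/((map (cat v) (root_hook (bt_node l' r'))) ::
      al (rcons v dleft) l' ++ ar (rcons v dright) r').
    rewrite -[hooks_from [::] _]/((map (cat [::]) (root_hook (bt_node l' r'))) ::
      al (rcons [::] dleft) l' ++ ar (rcons [::] dright) r').
    by rewrite /= !size_cat !al_l !ar_r.
  - rewrite -[al v _]/(hooks_from (rcons v dright) r' ++ al (rcons v dleft) l').
    by rewrite size_cat hr al_l.
  - rewrite -[ar v _]/(hooks_from (rcons v dleft) l' ++ ar (rcons v dright) r').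
    by rewrite size_cat hl ar_r.
have [_ al_l _] := E l; have [_ _ ar_r] := E r.
rewrite /hook_number /hooks -[hooks_from [::] _]/(
  (map (cat [::]) (root_hook (bt_node l r))) ::
    al (rcons [::] dleft) l ++ ar (rcons [::] dright) r).
by rewrite /= size_cat al_l ar_r.
Qed.

(** What a subtree adds to the branch on which it hangs; unlike in [branch], its own root counts. *)
Definition chain_length (d : bool) (B : bintree) : nat :=
  if B is bt_empty then 0%N else (size (branch d B)).+1.

Lemma size_branch_node d l r :
  size (branch d (bt_node l r)) = chain_length d (if d then r else l).
Proof.
rewrite (perm_size (branch_node d l r)) size_map /=.
by case: (if d then r else l).
Qed.

Definition inty (R : nmodType) (f : bseries R) : bseries R :=
  fun w => hprim (f w).
Definition intx (R : comNzRingType) (f : bseries R) : bseries R := hprim f.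

Lemma intxM (R : comNzRingType) (c : R) f : intx (bconst c * f) = bconst c * intx f.
Proof.
by apply: bseries_eq => -[|w] h; rewrite bconstM ?mulr0 // /intx /= bconstM.
Qed.

Lemma intyM (R : comNzRingType) (c : R) f : inty (bconst c * f) = bconst c * inty f.
Proof.
by apply: bseries_eq => w [|h]; rewrite bconstM ?mulr0 // /inty /= bconstM.
Qed.

Lemma intx_tensor (R : comNzRingType) (f g : hseries R) :
  intx (tensor f g) = tensor (hprim f) g.
Proof. by apply: bseries_eq => -[|w] h //; rewrite /tensor /= mul0r. Qed.

Lemma inty_tensor (R : comNzRingType) (f g : hseries R) :
  inty (tensor f g) = tensor f (hprim g).
Proof. by apply: bseries_eq => w [|h] //; rewrite /tensor /= mulr0. Qed.

Lemma intx_sum (R : comNzRingType) I (r : seq I) (F : I -> bseries R) :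
  intx (\sum_(i <- r) F i) = \sum_(i <- r) intx (F i).
Proof.
apply: (big_morph (@intx R)) => [f g|]; apply: bseries_eq => -[|w] h //.
by rewrite bcoefD addr0.
Qed.

Lemma inty_sum (R : comNzRingType) I (r : seq I) (F : I -> bseries R) :
  inty (\sum_(i <- r) F i) = \sum_(i <- r) inty (F i).
Proof.
apply: (big_morph (@inty R)) => [f g|]; apply: bseries_eq => w [|h] //.
by rewrite bcoefD addr0.
Qed.

Lemma bconstMM (R : comNzRingType) (a b : R) : bconst a * bconst b = bconst (a * b).
Proof. by apply: bseries_eq => -[|w] [|h]; rewrite bconstM ?mulr0. Qed.

Lemma bconstMA (R : comNzRingType) (a b : R) (f : bseries R) :
  bconst a * (bconst b * f) = bconst (a * b) * f.
Proof. by rewrite mulrA bconstMM. Qed.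

(* Four weights of a subtree, by its position: [left_series] when it hangs from
   the leftmost branch of the root as a left subtree, which continues the branch;
   [rsub_series] when it hangs from it as a right subtree, which starts new hooks;
   [right_series] and [lsub_series] are symmetric. Their sums are A, U, B
   and W. *)
Definition left_series (R : comNzRingType) (t a : R) (B : bintree) : bseries R :=
  bconst (t ^+ hook_left B * a ^+ chain_length dleft B) *
    tensor (chain_series R dleft B) (lab_series R (RV B)).
Definition right_series (R : comNzRingType) (t b : R) (B : bintree) : bseries R :=
  bconst (t ^+ hook_right B * b ^+ chain_length dright B) *
    tensor (lab_series R (LV B)) (chain_series R dright B).
Definition rsub_series (R : comNzRingType) (t : R) (B : bintree) : bseries R :=
  bconst (t ^+ hook_number B) *
    tensor (lab_series R (LV B)) (chain_series R dright B).
Definition lsub_series (R : comNzRingType) (t : R) (B : bintree) : bseries R :=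
  bconst (t ^+ hook_number B) *
    tensor (chain_series R dleft B) (lab_series R (RV B)).
Definition tree_series (R : comNzRingType) (t a b : R) (B : bintree) : bseries R :=
  bconst (t ^+ hook_number B * (a ^+ LO B * b ^+ RO B)) *
    tensor (lab_series R (LV B)) (lab_series R (RV B)).

Lemma LV_node (R : comNzRingType) l r :
  lab_series R (LV (bt_node l r)) = chain_series R dleft l * lab_series R (LV r).
Proof. exact: lab_series_node. Qed.
Lemma RV_node (R : comNzRingType) l r :
  lab_series R (RV (bt_node l r)) = chain_series R dright r * lab_series R (RV l).
Proof. exact: lab_series_node. Qed.

Lemma tree_series_node (R : comNzRingType) (t a b : R) l r :
  tree_series t a b (bt_node l r) =
    bconst t * (left_series t a l * right_series t b r).
Proof.
rewrite /tree_series /left_series /right_series LV_node RV_node hook_number_node.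
rewrite /LO /RO !size_branch_node /= [in RHS]mulrACA tensorM !bconstMM bconstMA.
congr (bconst _ * tensor _ _); last exact: mulrC.
by rewrite exprS exprD; ring.
Qed.

(** The root is a left child on the leftmost branch, whence [a] and the integration in x; [l]
    continues the branch and [r] starts new hooks. *)
Lemma left_series_node (R : comNzRingType) (t a : R) l r :
  left_series t a (bt_node l r) =
    bconst a * intx (left_series t a l * rsub_series t r).
Proof.
rewrite /left_series /rsub_series [in RHS]mulrACA tensorM bconstMM intxM intx_tensor.
rewrite bconstMA RV_node -LV_node /chain_length size_branch_node.
congr (bconst _ * tensor _ _); last exact: mulrC.
by rewrite /= exprS exprD; ring.
Qed.

Lemma right_series_node (R : comNzRingType) (t b : R) l r :
  right_series t b (bt_node l r) =
    bconst b * inty (right_series t b r * lsub_series t l).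
Proof.
rewrite /right_series /lsub_series [in RHS]mulrACA tensorM bconstMM intyM inty_tensor.
rewrite bconstMA -RV_node LV_node /chain_length size_branch_node.
congr (bconst _ * tensor _ _); last exact: mulrC.
by rewrite /= exprS exprD; ring.
Qed.

(** Off the branch, any tree may occur, weighted by its hooks alone as in F1; its root is one more
    right child, whence the integration in y. *)
Lemma rsub_series_node (R : comNzRingType) (t : R) l r :
  rsub_series t (bt_node l r) =
    inty (bconst t * (left_series t 1 l * right_series t 1 r)).
Proof.
rewrite -tree_series_node /tree_series intyM inty_tensor.
by rewrite !expr1n !mulr1.
Qed.

Lemma lsub_series_node (R : comNzRingType) (t : R) l r :
  lsub_series t (bt_node l r) =
    intx (bconst t * (left_series t 1 l * right_series t 1 r)).
Proof.
rewrite -tree_series_node /tree_series intxM intx_tensor.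
by rewrite !expr1n !mulr1.
Qed.

Lemma tensor11 (R : comNzRingType) : tensor (1 : hseries R) 1 = 1.
Proof.
by apply: bseries_eq => -[|w] [|h]; rewrite /tensor /= ?mulr1 ?mulr0 ?mul0r.
Qed.

Lemma empty_series (R : comNzRingType) (t a : R) :
  [/\ left_series t a bt_empty = 1, right_series t a bt_empty = 1,
      rsub_series t bt_empty = 1 & lsub_series t bt_empty = 1].
Proof.
have E : tensor (1 : hseries R) (lab_series R [::]) = 1.
  by rewrite lab_series_nil tensor11.
have E' : tensor (lab_series R [::]) 1 = 1.
  by rewrite lab_series_nil tensor11.
by split; rewrite /left_series /right_series /rsub_series /lsub_series /=
  ?E ?E' ?expr0 ?mulr1.
Qed.

Lemma sum_trees_upto (V : nmodType) n (F : bintree -> V) :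
  \sum_(B <- trees_upto n.+1) F B = F bt_empty +
    \sum_(l <- trees_upto n) \sum_(r <- trees_upto n) F (bt_node l r).
Proof. by rewrite /= big_cons big_allpairs_dep. Qed.

(** Finite form, by bounded height, of A = 1 + alpha int_x (A U). The next three lemmas do the same
    for B, U and W. *)
Lemma left_sum (R : comNzRingType) (t a : R) n :
  \sum_(B <- trees_upto n.+1) left_series t a B =
  1 + bconst a * intx ((\sum_(B <- trees_upto n) left_series t a B) *
                       (\sum_(B <- trees_upto n) rsub_series t B)).
Proof.
rewrite sum_trees_upto; have [-> _ _ _] := empty_series t a; congr (_ + _).
rewrite big_distrlr /= intx_sum mulr_sumr; apply: eq_bigr => l _.
by rewrite intx_sum mulr_sumr; apply: eq_bigr => r _; rewrite left_series_node.
Qed.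

Lemma right_sum (R : comNzRingType) (t b : R) n :
  \sum_(B <- trees_upto n.+1) right_series t b B =
  1 + bconst b * inty ((\sum_(B <- trees_upto n) right_series t b B) *
                       (\sum_(B <- trees_upto n) lsub_series t B)).
Proof.
rewrite sum_trees_upto; have [_ -> _ _] := empty_series t b; congr (_ + _).
rewrite big_distrlr /= exchange_big inty_sum mulr_sumr; apply: eq_bigr => l _.
by rewrite inty_sum mulr_sumr; apply: eq_bigr => r _; rewrite right_series_node.
Qed.

Lemma rsub_sum (R : comNzRingType) (t : R) n :
  \sum_(B <- trees_upto n.+1) rsub_series t B =
  1 + inty (bconst t * ((\sum_(B <- trees_upto n) left_series t 1 B) *
                        (\sum_(B <- trees_upto n) right_series t 1 B))).
Proof.
rewrite sum_trees_upto; have [_ _ -> _] := empty_series t 1; congr (_ + _).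
rewrite big_distrlr /= mulr_sumr inty_sum; apply: eq_bigr => l _.
by rewrite mulr_sumr inty_sum; apply: eq_bigr => r _; rewrite rsub_series_node.
Qed.

Lemma lsub_sum (R : comNzRingType) (t : R) n :
  \sum_(B <- trees_upto n.+1) lsub_series t B =
  1 + intx (bconst t * ((\sum_(B <- trees_upto n) left_series t 1 B) *
                        (\sum_(B <- trees_upto n) right_series t 1 B))).
Proof.
rewrite sum_trees_upto; have [_ _ _ ->] := empty_series t 1; congr (_ + _).
rewrite big_distrlr /= mulr_sumr intx_sum; apply: eq_bigr => l _.
by rewrite mulr_sumr intx_sum; apply: eq_bigr => r _; rewrite lsub_series_node.
Qed.

Lemma tree_sum (R : comNzRingType) (t a b : R) n :
  \sum_(B <- trees_upto n.+1 | B != bt_empty) tree_series t a b B =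
  bconst t * ((\sum_(B <- trees_upto n) left_series t a B) *
              (\sum_(B <- trees_upto n) right_series t b B)).
Proof.
rewrite big_mkcond sum_trees_upto /= add0r big_distrlr mulr_sumr.
apply: eq_bigr => l _; rewrite mulr_sumr; apply: eq_bigr => r _.
exact: tree_series_node.
Qed.

(** * Solution of the system *)

Definition left_sol (R : comNzRingType) (t a : R) := expsub a 0 (binv t a).
Definition right_sol (R : comNzRingType) (t b : R) := expsub 0 b (binv t b).
(** U = 1 + t Y (1 + X) / (1 - t X Y), found by integrating F1 = t (1 + X) (1 + Y) / (1 - t X Y)^2
    in y, where dy = dY / (1 + Y). *)
Definition rsub_sol (R : comNzRingType) (t : R) :=
  expsub 0 0 (1 + bY * (bconst t * (1 + bX) * binv t 1)).
Definition lsub_sol (R : comNzRingType) (t : R) :=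
  expsub 0 0 (1 + bX * (bconst t * (1 + bY) * binv t 1)).

Lemma intx_eq (R : comNzRingType) (f g : bseries R) :
  (forall h, f 0%N h = (1 : bseries R) 0%N h) -> dx f = g -> f = 1 + intx g.
Proof.
move=> f0 fg; apply: bseries_eq => -[|w] h; rewrite bcoefD.
  by rewrite f0 addr0.
by rewrite -fg add0r.
Qed.

Lemma inty_eq (R : comNzRingType) (f g : bseries R) :
  (forall w, f w 0%N = (1 : bseries R) w 0%N) -> dy f = g -> f = 1 + inty g.
Proof.
move=> f0 fg; apply: bseries_eq => w [|h]; rewrite bcoefD.
  by rewrite f0 addr0.
have -> : (1 : bseries R) w h.+1 = 0 by case: w.
by rewrite -fg add0r.
Qed.

Lemma expsubZ (R : comNzRingType) (c a b : R) f :
  expsub a b (bconst c * f) = bconst c * expsub a b f.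
Proof. by rewrite -[in LHS](add0r a) -[in LHS](add0r b) expsubM expsub_const. Qed.

Lemma bconst0 (R : comNzRingType) : bconst (0 : R) = 0.
Proof. by apply: bseries_eq => -[|w] []. Qed.

Lemma stirling0S (R : comNzRingType) n : stirling (0 : R) n.+1 0 = 0.
Proof. by rewrite /= !addr0 mul0r. Qed.

Lemma binv1E (R : comNzRingType) (t : R) :
  binv t 1 = 1 + bconst t * bX * bY * binv t 1.
Proof. by rewrite -[X in X + _](binv1K t); ring. Qed.

(** After differentiation in x, the claim reads [Dx a (binv t a)] = a (1 - t X Y) ^ (- a) U in the
    coordinates X, Y. *)
Lemma left_solE (R : comNzRingType) (t a : R) :
  left_sol t a = 1 + bconst a * intx (left_sol t a * rsub_sol t).
Proof.
rewrite -intxM; apply: intx_eq => [h|].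
  rewrite /left_sol expsub_binv big_ord1 /rising big_nil expr0 !mul1r.
  by case: h => [|h]; rewrite ?stirling0S ?mulr0 // mulr1.
rewrite dx_expsub -expsubM !addr0 -expsubZ; congr expsub.
rewrite /Dx dx_binv; ring.
Qed.

Lemma right_solE (R : comNzRingType) (t b : R) :
  right_sol t b = 1 + bconst b * inty (right_sol t b * lsub_sol t).
Proof.
rewrite -intyM; apply: inty_eq => [w|].
  rewrite /right_sol expsub_binv big_ord_recl big1 ?addr0; last first.
    by move=> i _; rewrite /= !mulr0.
  rewrite /rising big_nil expr0 !mul1r.
  by case: w => [|w]; rewrite ?stirling0S ?mul0r // mulr1.
rewrite dy_expsub -expsubM !addr0 -expsubZ; congr expsub.
rewrite /Dy dy_binv; ring.
Qed.

Lemma mul_sol1 (R : comNzRingType) (t : R) : left_sol t 1 * right_sol t 1 =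
  expsub 0 0 ((1 + bX) * (1 + bY) * (binv t 1 * binv t 1)).
Proof. by rewrite -expsubM addr0 add0r expsub11. Qed.

Lemma rsub_solE (R : comNzRingType) (t : R) :
  rsub_sol t = 1 + inty (bconst t * (left_sol t 1 * right_sol t 1)).
Proof.
apply: inty_eq => [w|].
  rewrite /rsub_sol expsubD -[1]/(bconst 1) expsub_const bcoefD expsubE.
  rewrite big1 ?addr0 // => i _; rewrite big_ord1 bYM mulr0n !mulr0 //.
rewrite dy_expsub mul_sol1 -expsubZ; congr expsub.
rewrite /Dy dyD !dyM dyD dy1 dyX dyY dy_const dy_binv
  bconst0 -[bconst (1 : R)]/(1 : bseries R).
(* One factor 1 / (1 - t X Y) is expanded once, as 1 + t X Y / (1 - t X Y), since [ring] does not
   know this relation. *)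
have -> : (1 + bX) * (1 + bY) * (binv t 1 * binv t 1) =
  (1 + bX) * (1 + bY) * (binv t 1 * (1 + bconst t * bX * bY * binv t 1)).
  by rewrite -binv1E.
ring.
Qed.

Lemma lsub_solE (R : comNzRingType) (t : R) :
  lsub_sol t = 1 + intx (bconst t * (left_sol t 1 * right_sol t 1)).
Proof.
apply: intx_eq => [h|].
  rewrite /lsub_sol expsubD -[1]/(bconst 1) expsub_const bcoefD expsubE.
  rewrite big_ord1 big1 ?addr0 // => i _; rewrite bXM mulr0n !mulr0 //.
rewrite dx_expsub mul_sol1 -expsubZ; congr expsub.
rewrite /Dx dxD !dxM dxD dx1 dxX dxY dx_const dx_binv
  bconst0 -[bconst (1 : R)]/(1 : bseries R).
have -> : (1 + bX) * (1 + bY) * (binv t 1 * binv t 1) =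
  (1 + bX) * (1 + bY) * (binv t 1 * (1 + bconst t * bX * bY * binv t 1)).
  by rewrite -binv1E.
ring.
Qed.

(** * Comparison of the trees with the solution *)

Lemma eqdeg_intx (R : comNzRingType) n (f g : bseries R) :
  eqdeg n f g -> eqdeg n.+1 (1 + intx f) (1 + intx g).
Proof. by move=> fg [|w] h wh; rewrite !bcoefD // /intx /= fg. Qed.

Lemma eqdeg_inty (R : comNzRingType) n (f g : bseries R) :
  eqdeg n f g -> eqdeg n.+1 (1 + inty f) (1 + inty g).
Proof. by move=> fg w [|h] wh; rewrite !bcoefD // /inty /= fg //; lia. Qed.

Lemma eqdeg_refl (R : comNzRingType) n (f : bseries R) : eqdeg n f f.
Proof. by []. Qed.

(** The finite sums and the closed forms obey the same equations, each of them 1 plus an integral.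
    Integration gains one degree, as does each increase of the height bound. *)
Lemma sol_approx (R : comNzRingType) (t : R) n :
  [/\ forall a, eqdeg n.+1 (\sum_(B <- trees_upto n) left_series t a B) (left_sol t a),
      forall b, eqdeg n.+1 (\sum_(B <- trees_upto n) right_series t b B) (right_sol t b),
      eqdeg n.+1 (\sum_(B <- trees_upto n) rsub_series t B) (rsub_sol t)
    & eqdeg n.+1 (\sum_(B <- trees_upto n) lsub_series t B) (lsub_sol t)].
Proof.
elim: n => [|n [IHl IHr IHu IHw]].
  have deg1x (f : bseries R) : eqdeg 1 1 (1 + intx f).
    by move=> [|w] [|h] // _; rewrite bcoefD addr0.
  have deg1y (f : bseries R) : eqdeg 1 1 (1 + inty f).
    by move=> [|w] [|h] // _; rewrite bcoefD addr0.
  split=> [a|b||]; rewrite big_seq1.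
  - by have [-> _ _ _] := empty_series t a; rewrite left_solE -intxM.
  - by have [_ -> _ _] := empty_series t b; rewrite right_solE -intyM.
  - by have [_ _ -> _] := empty_series t 1; rewrite rsub_solE.
  - by have [_ _ _ ->] := empty_series t 1; rewrite lsub_solE.
split=> [a|b||].
- rewrite left_sum left_solE -!intxM; apply: eqdeg_intx.
  by apply: eqdegM; [exact: eqdeg_refl|exact: eqdegM].
- rewrite right_sum right_solE -!intyM; apply: eqdeg_inty.
  by apply: eqdegM; [exact: eqdeg_refl|exact: eqdegM].
- rewrite rsub_sum rsub_solE; apply: eqdeg_inty.
  by apply: eqdegM; [exact: eqdeg_refl|exact: eqdegM].
- rewrite lsub_sum lsub_solE; apply: eqdeg_intx.
  by apply: eqdegM; [exact: eqdeg_refl|exact: eqdegM].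
Qed.

(** Coefficient of F = t A B; the powers of 1 - t X Y in A and B combine by [binvD], which produces
    [a + b]. *)
Lemma tree_series_coef (R : comNzRingType) (t a b : R) w h n : (w + h <= n)%N ->
  \sum_(B <- trees_upto n.+1 | B != bt_empty)
     t ^+ hook_number B * (a ^+ LO B * b ^+ RO B) *
       (lab_count (LV B) w * lab_count (RV B) h)%:R =
  \sum_(k < w.+1) t ^+ k.+1 *
    (k`!%:R * rising (a + b) k * stirling a w k * stirling b h k).
Proof.
move=> wh; have [Hl Hr _ _] := sol_approx t n.
have := eqdegM (@eqdeg_refl _ n.+1 (bconst t)) (eqdegM (Hl a) (Hr b)).
move=> /(_ w h); rewrite ltnS => /(_ wh).
rewrite -tree_sum -expsubM addr0 add0r binvD bconstM expsub_binv mulr_sumr.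
rewrite !hcoef_sum => E; under [RHS]eq_bigr do rewrite exprS -mulrA.
rewrite -{}E; apply: eq_bigr => B _.
by rewrite /tree_series bconstM /tensor /lab_series natrM.
Qed.

(** * Summation over non-ambiguous trees *)

Lemma sum_shape (V : nmodType) w h (F : bintree -> V) :
  \sum_(B : Defs.shape w h) F B =
  \sum_(B <- trees_upto (w + h).+1 | has_shape w h B) F B.
Proof.
rewrite -[RHS]big_filter.
have -> : [seq B <- trees_upto (w + h).+1 | has_shape w h B] =
    map (@shape_tree w h) (shape_enum w h).
  rewrite /shape_enum; elim: (trees_upto _) => //= B s IH.
  by case: insubP => [u -> /= <-|/negPf->] //; rewrite IH.
rewrite big_map; apply: perm_big; apply: uniq_perm.
- exact: index_enum_uniq.
- exact/pmap_sub_uniq/trees_upto_uniq.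
by move=> B; rewrite mem_index_enum -has_pred1 has_count shape_enumP.
Qed.

(** The two labellings of a tree are independent, so their numbers multiply. Trees of another shape
    may stay in the sum, as [lab_count] vanishes at a wrong size. *)
Lemma sum_NAT (R : comNzRingType) w h (G : bintree -> R) :
  \sum_(T : NAT w h) G (NAT_tree T) =
  \sum_(B <- trees_upto (w + h).+1 | B != bt_empty)
     G B * (lab_count (LV B) w * lab_count (RV B) h)%:R.
Proof.
transitivity (\sum_(B : Defs.shape w h)
    G B * (lab_count (LV B) w * lab_count (RV B) h)%:R).
  pose X := {B : Defs.shape w h & (labelling (LV B) w * labelling (RV B) h)%type}.
  pose P (x : X) := NAT_labelling (tagged x).1 && NAT_labelling (tagged x).2.
  transitivity (\sum_(x : X | P x) G (tag x)).
    symmetry; rewrite (reindex_omap (val : NAT w h -> X) insub) => [|x Px].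
      by apply: eq_bigl => -[x Px] /=; rewrite [P x]Px insubT /= eqxx.
    by rewrite insubT.
  pose J (B : Defs.shape w h) : finType :=
    (labelling (LV B) w * labelling (RV B) h)%type.
  pose Q (B : Defs.shape w h) : pred (J B) :=
    fun f => NAT_labelling f.1 && NAT_labelling f.2.
  rewrite -(@sig_big_dep _ _ _ _ J xpredT Q (fun B _ => G B)).
  apply: eq_bigr => B _; rewrite sumr_const mulr_natr; congr (_ *+ _).
  have [LB RB] : size (LV B) = w /\ size (RV B) = h.
    by have /and3P[_ /eqP-> /eqP->] := valP B.
  rewrite -(card_NAT_labelling LB) ?children_uniq //.
  rewrite -(card_NAT_labelling RB) ?children_uniq // -cardX.
  by apply: eq_card.
rewrite (sum_shape w h (fun B => G B * (lab_count (LV B) w * lab_count (RV B) h)%:R)).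
rewrite big_mkcond [RHS]big_mkcond; apply: eq_bigr => B _; rewrite /has_shape.
case: eqVneq => //= _; case: eqVneq => [_|Lw] /=; last first.
  by rewrite (lab_count_size Lw) mul0n mulr0.
by case: eqVneq => // Rh; rewrite (lab_count_size Rh) muln0 mulr0.
Qed.

Lemma stirling_rmorph (R S : comNzRingType) (f : {rmorphism R -> S}) (a : R) n k :
  f (stirling a n k) = stirling (f a) n k.
Proof.
elim: n k => [|n IH] k /=; first by rewrite rmorph_nat.
by rewrite rmorphD rmorphM rmorphD rmorph_nat IH; case: k => [|k]; rewrite ?rmorph0 ?IH.
Qed.

Lemma rising_rmorph (R S : comNzRingType) (f : {rmorphism R -> S}) (s : R) k :
  f (rising s k) = rising (f s) k.
Proof.
rewrite rmorph_prod; apply: eq_bigr => i _.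
by rewrite rmorphD rmorph_nat.
Qed.

Lemma hook_summandE (R : comNzRingType) w h (a b : R) k :
  hook_summand w h a b k.+1 =
  k`!%:R * rising (a + b) k * stirling a w k * stirling b h k.
Proof. by rewrite /hook_summand !S2q_stirling. Qed.

Lemma hook_summand_small (R : comNzRingType) w h (a b : R) k :
  (minn w h < k)%N -> hook_summand w h a b k.+1 = 0.
Proof.
rewrite hook_summandE gtn_min => /orP[wk|hk].
  by rewrite (stirling_small _ wk) mulr0 mul0r.
by rewrite (stirling_small _ hk) mulr0.
Qed.

(** The ring and [t] are arbitrary: [t = 1] gives the total sum, an indeterminate [t] separates the
    hook numbers. *)
Lemma NAT_hook_sum (R : comNzRingType) (t a b : R) w h :
  \sum_(T : NAT w h) t ^+ hook_number (NAT_tree T) * NAT_weight a b T =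
  \sum_(k < w.+1) t ^+ k.+1 * hook_summand w h a b k.+1.
Proof.
under [RHS]eq_bigr do rewrite hook_summandE.
rewrite -(tree_series_coef t a b (leqnn _)).
exact: (sum_NAT w h (fun B => t ^+ hook_number B * (a ^+ LO B * b ^+ RO B))).
Qed.

(* The sum over p >= 1 is finite: all its partial sums of length m > min(w, h)
   are equal to N_{w,h}(alpha, beta). *)
Theorem mainTheorem5 (R : comNzRingType) (alpha beta : R) (w h : nat) :
  (forall m : nat, (minn w h < m)%N ->
     NAT_poly w h alpha beta =
       \sum_(1 <= p < m.+1) hook_summand w h alpha beta p)
  /\ (forall p : nat, (1 <= p)%N ->
        hook_summand w h alpha beta p =
          \sum_(T : NAT w h | hook_number (NAT_tree T) == p)
             NAT_weight alpha beta T).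
Proof.
split=> [m hm|[//|k] _].
  have := NAT_hook_sum 1 alpha beta w h.
  under eq_bigr do rewrite expr1n mul1r.
  under [X in _ = X -> _]eq_bigr do rewrite expr1n mul1r.
  rewrite /NAT_poly => ->; rewrite big_add1 /= big_mkord.
  (* All long enough partial sums agree, in particular those of lengths [m] and [w + 1]. *)
  have E n : (minn w h < n)%N ->
      \sum_(i < n) hook_summand w h alpha beta i.+1 =
      \sum_(i < (minn w h).+1) hook_summand w h alpha beta i.+1.
    move=> hn; rewrite [RHS](big_ord_widen_cond n xpredT
      (fun i => hook_summand w h alpha beta i.+1)) //.
    rewrite [RHS]big_mkcond; apply: eq_bigr => i _; case: ltnP => // hi.
    exact: hook_summand_small.
  by rewrite !E // ltnS geq_minl.
(* With [t = 'X] over [{poly R}], the coefficient at [k.+1] selects the trees with that hook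
   number. *)
have /(congr1 (fun q : {poly R} => q`_k.+1)) :=
  NAT_hook_sum 'X alpha%:P beta%:P w h.
rewrite !coef_sum.
under eq_bigr => T _.
  rewrite /NAT_weight -!rmorphXn -rmorphM coefMC coefXn.
  over.
under [X in _ = X -> _]eq_bigr => i _.
  (* The summands are constant polynomials, so only the power of ['X] matters. *)
  have -> : hook_summand w h alpha%:P beta%:P i.+1 =
      (hook_summand w h alpha beta i.+1)%:P.
    rewrite !hook_summandE !rmorphM rmorph_nat !(stirling_rmorph polyC).
    by rewrite (rising_rmorph polyC) rmorphD.
  rewrite coefMC coefXn eqSS.
  over.
move=> E; rewrite [RHS]big_mkcond.
transitivity (\sum_(i < w.+1) (k == i)%:R * hook_summand w h alpha beta i.+1).
  case: (ltnP k w.+1) => kw; last first.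
    rewrite hook_summand_small; last by rewrite gtn_min kw.
    rewrite big1 // => i _; case: eqP => [ki|_]; last by rewrite mul0r.
    by have := ltn_ord i; rewrite -ki ltnNge kw.
  rewrite (bigD1 (Ordinal kw)) //= eqxx mul1r big1 ?addr0 // => i ik.
  case: eqP => [ki|]; last by rewrite mul0r.
  by case/eqP: ik; apply/val_inj.
rewrite -{}E; apply: eq_bigr => T _; rewrite eq_sym.
by case: eqP => _; rewrite ?mul1r ?mul0r.
Qed.
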